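(* Let $T$ be $\mathrm{DLO}$ or $\mathrm{DOAG}$ and $\boldsymbol{M}\models T$. A definable set $D\subseteq\boldsymbol{M}^{(x;y)}$ is stable with respect to $(x;y)$ if and only if $D$ is a finite union of special stable sets. Equivalently, an $L(\boldsymbol{M})$-formula $\varphi(x;y)$ is stable if and only if it is $T$-equivalent to a finite disjunction of formulas of the form $\psi(x)\wedge\theta(y)\wedge\chi(x,y)$ with $\psi,\theta$ arbitrary $L(\boldsymbol{M})$-formulas and $\chi$ a Boolean combination of atomic $L(\boldsymbol{M})$-formulas not containing $<$.
   Context: $\mathrm{DLO}=\mathrm{Th}(\mathbb{R},<)$ in $L=\{<\}$, $\mathrm{DOAG}=\mathrm{Th}(\mathbb{R},+,<)$ in the ordered group language; ''definable'' means definable with parameters. A definable $D\subseteq\boldsymbol{M}^{(x;y)}$ is unstable with respect to $(x;y)$ if there are $a_i\in\boldsymbol{M}^x$, $b_j\in\boldsymbol{M}^y$ ($i,j<\omega$) with $(a_i,b_j)\in D$ iff $i\le j$; otherwise stable. A set is equationally definable if it is defined by a Boolean combination of atomic formulas with parameters not involving $<$. $D$ is special stable if $D=Z\cap(X\times Y)$ for some definable $X\subseteq\boldsymbol{M}^x$, $Y\subseteq\boldsymbol{M}^y$ and equationally definable $Z\subseteq\boldsymbol{M}^{(x;y)}$. *)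

(* Defs.v *)
From mathcomp Require Import all_boot.
Set Implicit Arguments. Unset Strict Implicit. Unset Printing Implicit Defensive.

(** * Structures for the language {<} (DLO) and the ordered group language
      {0, +, -, <} (DOAG).  For DLO the group symbols are present in the
      structure but not allowed in formulas (see [term_ok]). *)
Record lstruct := LStruct {
  carrier :> Type;
  slt : carrier -> carrier -> Prop;
  szero : carrier;
  sadd : carrier -> carrier -> carrier;
  sopp : carrier -> carrier }.

Inductive theory := DLO | DOAG.

Fixpoint nsmul (M : lstruct) (k : nat) (b : M) : M :=
  match k with 0 => szero M | k'.+1 => sadd b (nsmul k' b) end.

Definition strict_linear_order (M : lstruct) : Prop :=
  (forall a : M, ~ slt a a) /\
  (forall a b c : M, slt a b -> slt b c -> slt a c) /\
  (forall a b : M, slt a b \/ a = b \/ slt b a).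

Definition models (T : theory) (M : lstruct) : Prop :=
  match T with
  | DLO =>
      inhabited (carrier M) /\ strict_linear_order M /\
      (forall a b : M, slt a b -> exists c, slt a c /\ slt c b) /\
      (forall a : M, exists b, slt b a) /\ (forall a : M, exists b, slt a b)
  | DOAG =>
      (forall a b c : M, sadd a (sadd b c) = sadd (sadd a b) c) /\
      (forall a b : M, sadd a b = sadd b a) /\
      (forall a : M, sadd (szero M) a = a) /\
      (forall a : M, sadd (sopp a) a = szero M) /\
      strict_linear_order M /\
      (forall a b c : M, slt a b -> slt (sadd a c) (sadd b c)) /\
      (forall (a : M) (k : nat), 0 < k -> exists b, nsmul k b = a) /\
      (exists a : M, a <> szero M)
  end.

Inductive term (M : Type) :=
  | TVar (i : nat) | TPar (a : M) | TZero | TAdd (t u : term M) | TOpp (t : term M).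

Inductive formula (M : Type) :=
  | FTrue | FFalse
  | FEq (t u : term M) | FLt (t u : term M)
  | FNot (f : formula M) | FAnd (f g : formula M) | FOr (f g : formula M)
  | FEx (i : nat) (f : formula M) | FAll (i : nat) (f : formula M).

Arguments TVar {M}. Arguments TZero {M}. Arguments FTrue {M}. Arguments FFalse {M}.

Definition is_DOAG (T : theory) : bool := if T is DOAG then true else false.

Fixpoint term_ok (T : theory) (M : Type) (t : term M) : bool :=
  match t with
  | TVar _ | TPar _ => true
  | TZero => is_DOAG T
  | TAdd t u => is_DOAG T && term_ok T t && term_ok T u
  | TOpp t => is_DOAG T && term_ok T t
  end.

Fixpoint form_ok (T : theory) (M : Type) (f : formula M) : bool :=
  match f with
  | FTrue | FFalse => true
  | FEq t u | FLt t u => term_ok T t && term_ok T u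
  | FNot f => form_ok T f
  | FAnd f g | FOr f g => form_ok T f && form_ok T g
  | FEx _ f | FAll _ f => form_ok T f
  end.

Fixpoint eq_qf (M : Type) (f : formula M) : bool :=
  match f with
  | FTrue | FFalse | FEq _ _ => true
  | FLt _ _ => false
  | FNot f => eq_qf f
  | FAnd f g | FOr f g => eq_qf f && eq_qf g
  | FEx _ _ | FAll _ _ => false
  end.

Fixpoint eval (M : lstruct) (v : nat -> M) (t : term M) : M :=
  match t with
  | TVar i => v i
  | TPar a => a
  | TZero => szero M
  | TAdd t u => sadd (eval v t) (eval v u)
  | TOpp t => sopp (eval v t)
  end.

Definition upd (M : Type) (v : nat -> M) (i : nat) (a : M) : nat -> M :=
  fun j => if j == i then a else v j.

Fixpoint sat (M : lstruct) (v : nat -> M) (f : formula M) : Prop :=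
  match f with
  | FTrue => True
  | FFalse => False
  | FEq t u => eval v t = eval v u
  | FLt t u => slt (eval v t) (eval v u)
  | FNot f => ~ sat v f
  | FAnd f g => sat v f /\ sat v g
  | FOr f g => sat v f \/ sat v g
  | FEx i f => exists a : M, sat (upd v i a) f
  | FAll i f => forall a : M, sat (upd v i a) f
  end.

(** Environments: the tuple x (length n) is assigned to variables 0..n-1,
    the tuple y (length m) to variables n..n+m-1; the remaining variables
    get values from [rest]. *)
Definition env1 (M : Type) (n : nat) (a : n.-tuple M) (rest : nat -> M) : nat -> M :=
  fun i => if i < n then nth (rest i) a i else rest i.

Definition env2 (M : Type) (n m : nat) (a : n.-tuple M) (b : m.-tuple M)
    (rest : nat -> M) : nat -> M :=
  fun i => if i < n then nth (rest i) a i
           else if i < n + m then nth (rest i) b (i - n) else rest i.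

Definition definable1 (T : theory) (M : lstruct) (n : nat)
    (X : n.-tuple M -> Prop) : Prop :=
  exists f : formula M, form_ok T f /\
    forall (a : n.-tuple M) (rest : nat -> M), X a <-> sat (env1 a rest) f.

Definition definable2 (T : theory) (M : lstruct) (n m : nat)
    (D : n.-tuple M -> m.-tuple M -> Prop) : Prop :=
  exists f : formula M, form_ok T f /\
    forall (a : n.-tuple M) (b : m.-tuple M) (rest : nat -> M),
      D a b <-> sat (env2 a b rest) f.

Definition eq_definable2 (T : theory) (M : lstruct) (n m : nat)
    (Z : n.-tuple M -> m.-tuple M -> Prop) : Prop :=
  exists f : formula M, form_ok T f /\ eq_qf f /\
    forall (a : n.-tuple M) (b : m.-tuple M) (rest : nat -> M),
      Z a b <-> sat (env2 a b rest) f.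

Definition unstable2 (M : Type) (n m : nat)
    (D : n.-tuple M -> m.-tuple M -> Prop) : Prop :=
  exists (a : nat -> n.-tuple M) (b : nat -> m.-tuple M),
    forall i j : nat, D (a i) (b j) <-> i <= j.

Definition stable2 (M : Type) (n m : nat)
    (D : n.-tuple M -> m.-tuple M -> Prop) : Prop := ~ unstable2 D.

Definition special_stable (T : theory) (M : lstruct) (n m : nat)
    (D : n.-tuple M -> m.-tuple M -> Prop) : Prop :=
  exists (X : n.-tuple M -> Prop) (Y : m.-tuple M -> Prop)
         (Z : n.-tuple M -> m.-tuple M -> Prop),
    definable1 T X /\ definable1 T Y /\ eq_definable2 T Z /\
    forall a b, D a b <-> (Z a b /\ X a /\ Y b).

(* Main.v *)
Require Import Defs.
From mathcomp Require Import all_boot.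
From HB Require Import structures.
From mathcomp Require Import all_order all_algebra boolp ring.
From Stdlib Require List.
Set Implicit Arguments. Unset Strict Implicit. Unset Printing Implicit Defensive.

(** Stability is preserved by Boolean combinations in the following strong form:
    every pair of sequences has an infinite subsequence along which membership
    of [(a_i, b_j)], [i <> j], has a constant truth value.  This holds for
    [X(x)], [Y(y)] and [f(x) = g(y)], and it excludes half graphs.

    For the converse, quantifier elimination shows that membership in [D] is
    determined by finitely many comparisons.  Let two points agree on the pure
    comparisons (in [x] alone or in [y] alone) and on all the equations, and
    differ on [D].  One passes from the first to the second by crossing the mixed
    comparisons one at a time.  Where a crossing changes [D], moving [x] and [y]
    independently near the crossing point makes them interleave, which is a half
    graph for [D].  In DLO a crossing exchanges two adjacent values.  In DOAG a
    crossing point on [f(x) + g(y) = 0] exists because the image of a polyhedron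
    under an affine functional is order-convex (Fourier-Motzkin), and [x] and [y]
    can be moved independently unless, on the flat [K] of the equations that
    hold, [f] or [g] is a combination of the others; in that case the comparison
    is equivalent on [K] to a pure one, which is added to the finite list. *)

(** In an ordered group a hyperplane can seldom be crossed alone: at the crossing point other
    comparisons on which the two ends differ may vanish too, for instance multiples of the crossed
    one. So the interleaving points near it are not asked to look like either end. They only have to
    keep every comparison on which the ends agree, to make no new equation true, and to lie on a
    prescribed side of the chosen hyperplane. Each then differs from the end on its side in fewer
    comparisons than the ends differ from each other, and induction on that number evaluates [D]
    there. In a dense order the analogous difficulty is that several coordinates may share a value;
    all of them are moved together, so equalities persist and a single pair of values is
    exchanged. *)

Section Tame.
Variables A B : Type.
Implicit Types D : A -> B -> Prop.

(** One [s] thins both sequences, so conjunctions are handled by thinning twice. The diagonal is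
    left out because an equation can hold exactly there; a half graph is still excluded, since it
    has different truth values above and below the diagonal. *)
Definition tame D := forall (a : nat -> A) (b : nat -> B),
  exists (s : nat -> nat) (p : Prop), {homo s : i j / i < j} /\
    forall i j, i <> j -> (D (a (s i)) (b (s j)) <-> p).

Lemma infinite_subseq (P : nat -> Prop) :
  (forall N, exists2 i, N <= i & P i) ->
  exists2 s : nat -> nat, {homo s : i j / i < j} & forall k, P (s k).
Proof.
move=> infP; have [g gP] : {g & forall N, N <= g N /\ P (g N)}.
  by apply: (@choice _ _ (fun N i => N <= i /\ P i)) => N; have [i] := infP N; exists i.
pose s := fix s k := if k is k'.+1 then g (s k').+1 else g 0.
exists s; last by case=> [|k]; [case: (gP 0) | case: (gP (s k).+1)].
by apply: homo_ltn => [i j k|k]; [exact: ltn_trans | case: (gP (s k).+1)].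
Qed.

Lemma subseq_dichotomy (P : nat -> Prop) :
  exists (s : nat -> nat) (p : Prop), {homo s : i j / i < j} /\ forall k, P (s k) <-> p.
Proof.
have [infP|/existsNP[N hN]] := pselect (forall N, exists2 i, N <= i & P i).
  by have [s sm sP] := infinite_subseq infP; exists s, True; split=> // k; split.
exists (fun k => N + k), False; split=> [i j|k]; first by rewrite ltn_add2l.
by split=> // PNk; apply: hN; exists (N + k) => //; exact: leq_addr.
Qed.

Lemma tame_left (X : A -> Prop) : tame (fun a _ => X a).
Proof.
by move=> a b; have [s [p [sm sP]]] := subseq_dichotomy (X \o a);
  exists s, p; split=> // i j _; exact: sP.
Qed.

Lemma tame_right (Y : B -> Prop) : tame (fun _ b => Y b).
Proof.
by move=> a b; have [s [p [sm sP]]] := subseq_dichotomy (Y \o b);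
  exists s, p; split=> // i j _; exact: sP.
Qed.

Lemma homo_inj (s : nat -> nat) : {homo s : i j / i < j} -> injective s.
Proof.
move=> sm i j sij; apply/eqP; rewrite eqn_leq leqNgt [j <= i]leqNgt.
by apply/andP; split; apply/negP => /sm; rewrite sij ltnn.
Qed.

Lemma tame_not D : tame D -> tame (fun a b => ~ D a b).
Proof.
move=> tD a b; have [s [p [sm sP]]] := tD a b.
by exists s, (~ p); split=> // i j /sP ->.
Qed.

Lemma tame_and D1 D2 : tame D1 -> tame D2 -> tame (fun a b => D1 a b /\ D2 a b).
Proof.
move=> t1 t2 a b; have [s1 [p1 [m1 h1]]] := t1 a b.
have [s2 [p2 [m2 h2]]] := t2 (a \o s1) (b \o s1).
exists (s1 \o s2), (p1 /\ p2); split=> [i j /m2/m1 //|i j ij].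
by rewrite /= -(h2 i j) // -(h1 (s2 i) (s2 j)) // => /(homo_inj m2).
Qed.

Lemma tame_or D1 D2 : tame D1 -> tame D2 -> tame (fun a b => D1 a b \/ D2 a b).
Proof.
move=> t1 t2; have := tame_not (tame_and (tame_not t1) (tame_not t2)).
by congr tame; do 2 apply: funext => ?; rewrite not_andE !notK.
Qed.

(** If one side takes some value infinitely often, thinning to that value leaves a condition on a
    single index. Otherwise every value recurs finitely often, and a sparse subsequence has no
    off-diagonal coincidence. *)
Lemma tame_eq (C : Type) (f : A -> C) (g : B -> C) : tame (fun a b => f a = g b).
Proof.
move=> a b; pose u := f \o a; pose w := g \o b.
pose often (x : nat -> C) c := forall N, exists2 i, N <= i & x i = c.
have rare x c : ~ often x c -> exists N, forall i, N <= i -> x i <> c.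
  move=> /existsNP[N hN]; exists N => i Ni xi; by apply: hN; exists i.
have [[c /infinite_subseq[s sm su]]|/forallNP fu] := pselect (exists c, often u c).
  have [r [p [rm rP]]] := subseq_dichotomy (fun k => c = w (s k)).
  exists (s \o r), p; split=> [i j /rm/sm //|i j _].
  by rewrite -(rP j) -(su (r i)).
have [[c /infinite_subseq[s sm sw]]|/forallNP fw] := pselect (exists c, often w c).
  have [r [p [rm rP]]] := subseq_dichotomy (fun k => u (s k) = c).
  exists (s \o r), p; split=> [i j /rm/sm //|i j _].
  by rewrite -(rP i) -(sw (r j)).
have [N hN] : {N & forall c, forall i, N c <= i -> u i <> c /\ w i <> c}.
  apply: (@choice _ _ (fun c N => forall i, N <= i -> u i <> c /\ w i <> c)) => c.
  have [N1 h1] := rare _ _ (fu c).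
  have [N2 h2] := rare _ _ (fw c); exists (maxn N1 N2) => i.
  by rewrite geq_max => /andP[/h1 ? /h2].
(* Each index lies beyond all occurrences, in [u] or in [w], of the two values found at the previous
   index. *)
pose s := fix s k := if k is k'.+1
  then maxn (s k').+1 (maxn (N (u (s k'))) (N (w (s k')))) else 0.
have sm : {homo s : i j / i < j}.
  by apply: homo_ltn => [i j k|k]; [exact: ltn_trans | rewrite /= leq_max ltnSn].
exists s, False; split=> // i j ij; split=> // e.
have big k l : k < l -> N (u (s k)) <= s l /\ N (w (s k)) <= s l.
  move=> kl; have : s k.+1 <= s l by move: kl; rewrite leq_eqVlt => /orP[/eqP->//|/sm/ltnW].
  by rewrite /= !geq_max => /and3P[].
case: (ltngtP i j) => // kl; have [h1 h2] := big _ _ kl.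
  by case: (hN _ _ h1) => _; apply; rewrite /u /= e.
by case: (hN _ _ h2) => + _; apply; rewrite /w /= -e.
Qed.

End Tame.

Lemma tame_stable n m (M : Type) (D : n.-tuple M -> m.-tuple M -> Prop) :
  tame D -> stable2 D.
Proof.
move=> tD [a [b ab]]; have [s [p [sm sP]]] := tD a b.
have pT : p by apply/(sP 0 1) => //; apply/ab; rewrite ltnW // sm.
by have /(sP 1 0 ltac:(by []))/ab := pT; rewrite leqNgt sm.
Qed.

(** * The Boolean algebra of finite unions of special stable sets *)

Section SpecialUnions.
Variables (T : theory) (M : lstruct) (n m : nat).
Implicit Types D : n.-tuple M -> m.-tuple M -> Prop.

Lemma definable1_true k : definable1 T (fun _ : k.-tuple M => True).
Proof. by exists FTrue. Qed.

Lemma definable1_not k (X : k.-tuple M -> Prop) :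
  definable1 T X -> definable1 T (fun a => ~ X a).
Proof. by case=> f [okf fP]; exists (FNot f); split=> //= a r; rewrite (fP a r). Qed.

Lemma definable1_and k (X Y : k.-tuple M -> Prop) :
  definable1 T X -> definable1 T Y -> definable1 T (fun a => X a /\ Y a).
Proof.
case=> f [okf fP] [g [okg gP]]; exists (FAnd f g); rewrite /= okf okg.
by split=> // a r; rewrite (fP a r) (gP a r).
Qed.

Lemma eq_definable2_true : eq_definable2 T (fun (_ : n.-tuple M) (_ : m.-tuple M) => True).
Proof. by exists FTrue. Qed.

Lemma eq_definable2_not D : eq_definable2 T D -> eq_definable2 T (fun a b => ~ D a b).
Proof.
by case=> f [okf [ef fP]]; exists (FNot f); split=> //; split=> //= a b r; rewrite (fP a b r).
Qed.

Lemma eq_definable2_and D1 D2 : eq_definable2 T D1 -> eq_definable2 T D2 ->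
  eq_definable2 T (fun a b => D1 a b /\ D2 a b).
Proof.
case=> f [okf [ef fP]] [g [okg [eg gP]]]; exists (FAnd f g); rewrite /= okf okg ef eg.
by split=> //; split=> // a b r; rewrite (fP a b r) (gP a b r).
Qed.

(** An inductive presentation lets Boolean closure go by induction; [special_unionP] returns to
    indexed unions. *)
Inductive special_union : (n.-tuple M -> m.-tuple M -> Prop) -> Prop :=
| su_none : special_union (fun _ _ => False)
| su_special D of special_stable T D : special_union D
| su_or D1 D2 of special_union D1 & special_union D2 :
    special_union (fun a b => D1 a b \/ D2 a b).

Lemma special_unionP D : special_union D <->
  exists (k : nat) (S : nat -> n.-tuple M -> m.-tuple M -> Prop),
    (forall i, i < k -> special_stable T (S i)) /\
    (forall a b, D a b <-> exists i, i < k /\ S i a b).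
Proof.
split=> [|[k [S [sS DS]]]].
  elim=> [|{}D sD|D1 D2 _ [k1 [S1 [s1 h1]]] _ [k2 [S2 [s2 h2]]]].
  - by exists 0, (fun _ _ _ => False); split=> // a b; split=> // -[i []].
  - by exists 1, (fun _ => D); split=> // a b; split=> [|[i []]//]; exists 0.
  exists (k1 + k2), (fun i => if i < k1 then S1 i else S2 (i - k1)).
  split=> [i ik|a b].
    by case: ltnP => [/s1//|ki]; apply: s2; rewrite ltn_subLR.
  rewrite h1 h2; split=> [[[i [ik Si]]|[i [ik Si]]]|[i [ik]]].
  - by exists i; rewrite ik; split=> //; rewrite (leq_trans ik) ?leq_addr.
  - by exists (k1 + i); rewrite ltn_add2l [_ < k1]ltnNge leq_addr addKn.
  case: ltnP => [ik1 Si|ki Si]; [left; by exists i|right; exists (i - k1)].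
  by rewrite ltn_subLR.
elim: k S D sS DS => [|k IH] S D sS DS.
  rewrite (_ : D = fun _ _ => False); first exact: su_none.
  by do 2 apply: funext => ?; apply/propext; rewrite DS; split=> // -[? []].
have -> : D = fun a b => (exists i, i < k /\ S i a b) \/ S k a b.
  do 2 apply: funext => ?; apply/propext; rewrite DS; split.
    move=> [i []]; rewrite ltnS leq_eqVlt => /orP[/eqP->|ik Si]; first by right.
    by left; exists i.
  by case=> [[i [ik Si]]|Sk]; [exists i; rewrite ltnS ltnW | exists k].
apply: su_or; last by apply: su_special; apply: sS.
by apply: (IH S) => // i ik; apply: sS; rewrite ltnS ltnW.
Qed.

Lemma special_stable_left (X : n.-tuple M -> Prop) :
  definable1 T X -> special_stable T (fun (a : n.-tuple M) (_ : m.-tuple M) => X a).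
Proof.
move=> dX; exists X, (fun _ => True), (fun _ _ => True).
split=> //; split; first exact: definable1_true.
split; first exact: eq_definable2_true.
by move=> a b; split=> // -[_ []].
Qed.

Lemma special_stable_right (Y : m.-tuple M -> Prop) :
  definable1 T Y -> special_stable T (fun (_ : n.-tuple M) (b : m.-tuple M) => Y b).
Proof.
move=> dY; exists (fun _ => True), Y, (fun _ _ => True).
split; first exact: definable1_true.
split=> //; split; first exact: eq_definable2_true.
by move=> a b; split=> // -[_ []].
Qed.

Lemma special_stable_eq (Z : n.-tuple M -> m.-tuple M -> Prop) :
  eq_definable2 T Z -> special_stable T Z.
Proof.
move=> dZ; exists (fun _ => True), (fun _ => True), Z.
split; first exact: definable1_true.
split; first exact: definable1_true.
by split=> // a b; split=> // -[].
Qed.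

Lemma special_stable_and D1 D2 : special_stable T D1 -> special_stable T D2 ->
  special_stable T (fun a b => D1 a b /\ D2 a b).
Proof.
move=> [X1 [Y1 [Z1 [dX1 [dY1 [dZ1 h1]]]]]] [X2 [Y2 [Z2 [dX2 [dY2 [dZ2 h2]]]]]].
exists (fun a => X1 a /\ X2 a), (fun a => Y1 a /\ Y2 a), (fun a b => Z1 a b /\ Z2 a b).
split; first exact: definable1_and.
split; first exact: definable1_and.
split; first exact: eq_definable2_and.
by move=> a b; rewrite h1 h2; tauto.
Qed.

Lemma special_union_and D1 D2 : special_union D1 -> special_union D2 ->
  special_union (fun a b => D1 a b /\ D2 a b).
Proof.
move=> + h2; elim=> [|D s|D D' _ IH _ IH'].
- rewrite (_ : (fun _ _ => _) = fun _ _ => False); first exact: su_none.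
  by do 2 apply: funext => ?; apply/propext; tauto.
- elim: h2 => [|D' s'|D' D'' _ IH _ IH'].
  + rewrite (_ : (fun _ _ => _) = fun _ _ => False); first exact: su_none.
    by do 2 apply: funext => ?; apply/propext; tauto.
  + by apply: su_special; apply: special_stable_and.
  have := su_or IH IH'; congr special_union.
  by do 2 apply: funext => ?; apply/propext; tauto.
have := su_or IH IH'; congr special_union.
by do 2 apply: funext => ?; apply/propext; tauto.
Qed.

(** A special stable set is cut out by three constraints; negating any one of them alone gives a
    special stable set again. *)
Lemma special_union_not D : special_union D -> special_union (fun a b => ~ D a b).
Proof.
elim=> [|{}D [X [Y [Z [dX [dY [dZ h]]]]]]|D1 D2 _ IH1 _ IH2].
- apply: su_special; have := special_stable_eq eq_definable2_true.
  by congr special_stable; do 2 apply: funext => ?; apply/propext; tauto.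
- have sX := su_special (special_stable_left (definable1_not dX)).
  have sY := su_special (special_stable_right (definable1_not dY)).
  have sZ := su_special (special_stable_eq (eq_definable2_not dZ)).
  have := su_or (su_or sX sY) sZ; congr special_union.
  do 2 apply: funext => ?; apply/propext; rewrite h !not_andE; tauto.
have := special_union_and IH1 IH2; congr special_union.
by do 2 apply: funext => ?; apply/propext; tauto.
Qed.

Lemma special_union_const (p : Prop) : special_union (fun _ _ => p).
Proof.
have [hp|hp] := pselect p.
  have := special_union_not su_none; congr special_union.
  by do 2 apply: funext => ?; apply/propext; tauto.
have := su_none; congr special_union.
by do 2 apply: funext => ?; apply/propext; tauto.
Qed.

(** Such a [D] is a union of some of the finitely many atoms of the Boolean algebra generated by the
    [A f]. The induction splits on the truth value of one predicate at a time, and it never requires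
    [D] to be definable. *)
Lemma special_union_determined (F : finType) (A : F -> n.-tuple M -> m.-tuple M -> Prop) D :
    (forall f, special_union (A f)) ->
    (forall a b a' b', (forall f, A f a b <-> A f a' b') -> D a b -> D a' b') ->
  special_union D.
Proof.
move=> sA; have : forall f, f \notin enum F -> False by move=> f; rewrite mem_enum.
move: (enum F) => s hs hD.
have {hs}hD : forall a b a' b',
    (forall f, f \in s -> (A f a b <-> A f a' b')) -> D a b -> D a' b'.
  move=> a b a' b' h; apply: hD => f; apply: h.
  by apply/negPn/negP => /hs.
elim: s D hD => [|f s IH] D hD.
  rewrite (_ : D = fun _ _ => exists a b, D a b); first exact: special_union_const.
  apply: funext => a; apply: funext => b; apply/propext; split; first by exists a, b.
  by move=> [a' [b']]; apply: hD.
(* [proj p] is the part of [D] where [A f] has truth value [p], saturated under agreement on the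
   predicates of [s]; saturation is what makes the induction hypothesis applicable. *)
pose proj (p : Prop) a b := exists a' b', [/\ D a' b', A f a' b' <-> p &
  forall g, g \in s -> (A g a' b' <-> A g a b)].
have sproj p : special_union (proj p).
  apply: IH => a b a' b' h [c [d [Dcd cp hcd]]]; exists c, d; split=> // g gs.
  by rewrite hcd // h.
have := su_or (special_union_and (sA f) (sproj True))
  (special_union_and (special_union_not (sA f)) (sproj False)).
congr special_union; apply: funext => a; apply: funext => b; apply/propext; split.
  case=> -[fab [a' [b' [D' fp h]]]]; apply: hD D' => g; rewrite inE => /orP[/eqP->|/h//];
  by rewrite fp; split.
move=> Dab; have [fab|fab] := pselect (A f a b); [left|right]; split=> //;
by exists a, b; split.
Qed.

Lemma special_union_stable D :
    (forall Z : n.-tuple M -> m.-tuple M -> Prop, eq_definable2 T Z -> tame Z) ->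
  special_union D -> stable2 D.
Proof.
move=> tZ sD; apply: tame_stable; elim: sD => [|{}D [X [Y [Z [_ [_ [/tZ dZ h]]]]]]|].
- exact: (tame_left (fun _ => False)).
- have := tame_and dZ (tame_and (tame_left X) (tame_right Y)); congr tame.
  by do 2 apply: funext => ?; apply/propext; rewrite h.
by move=> *; apply: tame_or.
Qed.

End SpecialUnions.

(** * Dense orders without endpoints, the common ground of DLO and DOAG *)

Record dense_unbounded_order (M : lstruct) : Prop := DenseUnboundedOrder {
  slt_inhabited : inhabited M;
  slt_irr : forall a : M, ~ slt a a;
  slt_trans : forall b a c : M, slt a b -> slt b c -> slt a c;
  slt_total : forall a b : M, slt a b \/ a = b \/ slt b a;
  slt_dense : forall a b : M, slt a b -> exists c, slt a c /\ slt c b;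
  slt_below : forall a : M, exists b, slt b a;
  slt_above : forall a : M, exists b, slt a b }.

(** Reversal turns facts on lower bounds into facts on upper bounds, and increasing sequences into
    decreasing ones. *)
Definition dual_order (M : lstruct) : lstruct :=
  LStruct (fun a b : M => slt b a) (szero M) (@sadd M) (@sopp M).

Lemma dual_dense_unbounded (M : lstruct) :
  dense_unbounded_order M -> dense_unbounded_order (dual_order M).
Proof.
case=> inh irr tr tot de lo hi; split=> //=; first by move=> b a c /[swap]; apply: tr.
- by move=> a b; have [|[->|]] := tot a b; tauto.
- by move=> a b /de[c [? ?]]; exists c.
Qed.

(** The non-strict comparison is a negated strict one, so that negating a comparison gives a
    comparison with the sides exchanged. *)
Definition cmp (M : lstruct) (strict : bool) (a b : M) : Prop :=
  if strict then slt a b else ~ slt b a.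

Section DenseOrder.
Variable M : lstruct.
Hypothesis ordM : dense_unbounded_order M.

Lemma slt_asym (a b : M) : slt a b -> ~ slt b a.
Proof. by move=> ab ba; apply: (slt_irr ordM (slt_trans ordM ab ba)). Qed.

Lemma slt_le_trans (b a c : M) : slt a b -> ~ slt c b -> slt a c.
Proof.
by move=> ab; have [bc _|[<-//|//]] := slt_total ordM b c; apply: (slt_trans ordM ab).
Qed.

Lemma le_slt_trans (b a c : M) : ~ slt b a -> slt b c -> slt a c.
Proof.
by move=> + bc; have [ab _|[->//|//]] := slt_total ordM a b; apply: (slt_trans ordM ab).
Qed.

(** Take the greatest bounding value; among bounds with equal values a strict one is stronger,
    whence the disjunction of the strictness flags. *)
Lemma strongest_lower (s : seq (bool * M)) : s <> [::] ->
  exists c, List.In c s /\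
    forall z, cmp c.1 c.2 z -> forall c', List.In c' s -> cmp c'.1 c'.2 z.
Proof.
elim: s => // -[b x] s IH _; case: s IH => [_|c0 s IH].
  by exists (b, x); split; [left|move=> z h c' [<-|[]]].
have [//|[b' x'] [ins hs]] := IH.
have [xx'|[xx'|x'x]] := slt_total ordM x x'.
- exists (b', x'); split; first by right.
  move=> z h c' [<-|/(hs _ h)//] /=; suff xz : slt x z by case: (b) => //; apply: slt_asym.
  by case: (b') h => /= h; [apply: (slt_trans ordM xx')|apply: slt_le_trans xx' h].
- exists (b || b', x); split; first by case: (b); [left|right; rewrite xx'].
  move=> z /= h c' [<-|inc'] /=.
    by move: h; case: (b) => //; case: (b') => //= /(slt_asym).
  apply: (hs z _ c' inc'); rewrite /= -xx'.
  by move: h; case: (b); case: (b') => //= /(slt_asym).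
- exists (b, x); split; first by left.
  move=> z h c' [<-//|inc']; apply: (hs z _ c' inc') => /=.
  have x'z : slt x' z.
    by case: (b) h => /= h; [apply: (slt_trans ordM x'x)|apply: slt_le_trans x'x h].
  by case: (b') => //; apply: slt_asym.
Qed.
End DenseOrder.

Section Betweenness.
Variable M : lstruct.
Hypothesis ordM : dense_unbounded_order M.

(* Helly's theorem in dimension one. *)
Lemma interval_nonempty (lo up : seq (bool * M)) :
    (forall c d, List.In c lo -> List.In d up -> cmp (c.1 || d.1) c.2 d.2) ->
  exists z, (forall c, List.In c lo -> cmp c.1 c.2 z) /\
            (forall d, List.In d up -> cmp d.1 z d.2).
Proof.
move=> h; have cmpW b (x y : M) : slt x y -> cmp b x y.
  by case: b => //= xy; apply: slt_asym xy.
have [lo0|/(strongest_lower ordM)[[b x] [inlo hlo]]] := pselect (lo = [::]);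
have [up0|/(strongest_lower (dual_dense_unbounded ordM))[[b' y] [inup hup]]] := pselect (up = [::]).
- by have [z] := slt_inhabited ordM; exists z; rewrite lo0 up0; split.
- have [z zy] := slt_below ordM y; exists z; rewrite lo0; split=> // d.
  by apply: hup; apply: cmpW.
- have [z xz] := slt_above ordM x; exists z; rewrite up0; split=> // d.
  by apply: hlo; apply: cmpW.
have := h _ _ inlo inup; rewrite /= => xy.
have [z xz zy] : exists2 z, cmp b x z & cmp b' z y.
  have [xy'|[xy'|yx]] := slt_total ordM x y.
  - by have [z [xz zy]] := slt_dense ordM xy'; exists z; apply: cmpW.
  - move: xy; rewrite xy'; case: (b); case: (b') => /= yy;
      try by case: (slt_irr ordM yy).
    by exists y.
  - by move: xy; case: (b || b') => /= [/(slt_asym ordM)|].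
by exists z; split; [apply: hlo|apply: hup].
Qed.
End Betweenness.

Lemma In_cons_all (A : Type) (P : A -> Prop) x (s : seq A) :
  (forall c, List.In c (x :: s) -> P c) <-> P x /\ (forall c, List.In c s -> P c).
Proof.
split=> [h|[px ps] c [<-//|/ps//]].
by split=> [|c cs]; apply: h; [left|right].
Qed.

Lemma In_cat_all (A : Type) (P : A -> Prop) (s1 s2 : seq A) :
  (forall c, List.In c (s1 ++ s2) -> P c) <->
  (forall c, List.In c s1 -> P c) /\ (forall c, List.In c s2 -> P c).
Proof.
split=> [h|[h1 h2] c /List.in_app_iff[/h1|/h2]//].
by split=> c cs; apply: h; apply/List.in_app_iff; [left|right].
Qed.

(** * Fourier-Motzkin elimination over an abstract class of terms *)

Section Elimination.
Variable M : lstruct.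
Hypothesis ordM : dense_unbounded_order M.
Notation env := (nat -> M).
Variable is_term : (env -> M) -> Prop.
Definition indep (i : nat) (t : env -> M) := forall v z, t (upd v i z) = t v.

(** Both directions of the order are preserved, so strict and non-strict literals can be exchanged
    alike. *)
Definition equi_sign (t s t' s' : env -> M) := forall v,
  (slt (t v) (s v) <-> slt (t' v) (s' v)) /\ (slt (s v) (t v) <-> slt (s' v) (t' v)).

(** The outcomes of solving a comparison for variable [i]: the variable disappears, or [r] bounds it
    from above, or [r] bounds it from below. *)
Definition solvable (i : nat) (t s : env -> M) :=
  [\/ exists t' s', [/\ is_term t', is_term s', indep i t', indep i s' & equi_sign t s t' s'],
      exists r, [/\ is_term r, indep i r & equi_sign t s (fun v => v i) r] |
      exists r, [/\ is_term r, indep i r & equi_sign t s r (fun v => v i)]].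

Hypothesis solve : forall i t s, is_term t -> is_term s -> solvable i t s.

Definition literal := (bool * ((env -> M) * (env -> M)))%type.
Definition holds (c : literal) v := cmp c.1 (c.2.1 v) (c.2.2 v).
Definition holds_all (l : seq literal) v := forall c, List.In c l -> holds c v.
Definition literals (l : seq literal) :=
  forall c, List.In c l -> is_term c.2.1 /\ is_term c.2.2.

Lemma equi_sign_cmp t s t' s' b v : equi_sign t s t' s' ->
  cmp b (t v) (s v) <-> cmp b (t' v) (s' v).
Proof. by move=> /(_ v)[h1 h2]; case: b => /=; rewrite ?h1 ?h2. Qed.

Lemma upd_upd (v : env) i x y : upd (upd v i x) i y = upd v i y.
Proof. by apply: funext => j; rewrite /upd; case: eqP. Qed.

Lemma upd_eq (v : env) i x : upd v i x i = x.
Proof. by rewrite /upd eqxx. Qed.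

Lemma sort_literals i l : literals l ->
  exists (ind : seq literal) (lo up : seq (bool * (env -> M))),
  [/\ literals ind,
      forall c, List.In c lo -> is_term c.2,
      forall c, List.In c up -> is_term c.2 &
      forall v z, holds_all l (upd v i z) <-> holds_all ind v /\
        (forall c, List.In c lo -> cmp c.1 (c.2 v) z) /\
        (forall c, List.In c up -> cmp c.1 z (c.2 v))].
Proof.
elim: l => [|[b [t s]] l IH] okl.
  by exists [::], [::], [::]; split=> // v z; split=> [_|_ c []]; split; [|split] => c [].
have /IH[ind [lo [up [okind oklo okup h]]]] : literals l by move=> c cl; apply: okl; right.
have [tt ts] : is_term t /\ is_term s by apply: (okl (b, (t, s))); left.
have [[t' [s' [tt' ts' it is_ e]]]|[r [tr ir e]]|[r [tr ir e]]] := solve i tt ts.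
- exists ((b, (t', s')) :: ind), lo, up; split=> //; first by move=> c [<-|/okind].
  move=> v z; rewrite /holds_all In_cons_all -/(holds_all l _) h In_cons_all.
  rewrite -/(holds_all ind _) /holds /= (equi_sign_cmp b _ e) it is_.
  tauto.
- exists ind, lo, ((b, r) :: up); split=> //; first by move=> c [<-|/okup].
  move=> v z; rewrite /holds_all !In_cons_all -/(holds_all l _) h /holds /=.
  by rewrite (equi_sign_cmp b _ e) upd_eq ir; tauto.
- exists ind, ((b, r) :: lo), up; split=> //; first by move=> c [<-|/oklo].
  move=> v z; rewrite /holds_all !In_cons_all -/(holds_all l _) h /holds /=.
  by rewrite (equi_sign_cmp b _ e) upd_eq ir; tauto.
Qed.

(** By the one-dimensional Helly theorem, a solution [z] exists once every lower bound is compatible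
    with every upper bound. A pair is strict as soon as one of its members is. *)
Lemma fourier_motzkin i l : literals l -> exists2 l', literals l' &
  forall v, (exists z, holds_all l (upd v i z)) <-> holds_all l' v.
Proof.
move=> /(sort_literals i)[ind [lo [up [okind oklo okup h]]]].
pose pairs := List.flat_map (fun c : bool * (env -> M) =>
  List.map (fun d : bool * (env -> M) => (c.1 || d.1, (c.2, d.2)) : literal) up) lo.
have pairsP c : List.In c pairs <-> exists x y, [/\ List.In x lo, List.In y up &
    c = (x.1 || y.1, (x.2, y.2))].
  rewrite /pairs List.in_flat_map; split=> [[x [xl /List.in_map_iff[y [<- yl]]]]|].
    by exists x, y.
  move=> [x [y [xl yl ->]]]; exists x; split=> //.
  by apply/List.in_map_iff; exists y.
exists (ind ++ pairs).
  apply/In_cat_all; split=> // c /pairsP[x [y [/oklo tx /okup ty ->]]] //.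
move=> v; rewrite /holds_all In_cat_all -/(holds_all ind v); split.
  move=> [z /h[hi [hl hu]]]; split=> // c /pairsP[x [y [/hl lx /hu uy ->]]].
  rewrite /holds /=; case: x.1 lx; case: y.1 uy => /= uy lx.
  - exact: (slt_trans ordM lx uy).
  - exact: (slt_le_trans ordM lx uy).
  - exact: (le_slt_trans ordM lx uy).
  - by move=> yx; apply: lx; apply: (le_slt_trans ordM uy yx).
move=> [hi hp].
pose ev := List.map (fun c : bool * (env -> M) => (c.1, c.2 v)).
have evP s c : List.In c (ev s) <-> exists x, List.In x s /\ c = (x.1, x.2 v).
  by rewrite /ev List.in_map_iff; split=> -[x [? ?]]; exists x.
have [|z [hl hu]] := @interval_nonempty M ordM (ev lo) (ev up).
  move=> c d /evP[x [xl ->]] /evP[y [yl ->]] /=.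
  by apply: (hp (x.1 || y.1, (x.2, y.2))); apply/pairsP; exists x, y.
exists z; apply/h; split=> //; split=> c cl.
  by apply: (hl (c.1, c.2 v)); apply/evP; exists c.
by apply: (hu (c.1, c.2 v)); apply/evP; exists c.
Qed.

Lemma eliminate_all k l : literals l -> exists2 l', literals l' &
  forall v, (exists v' : env, (forall j, k <= j -> v' j = v j) /\ holds_all l v') <->
    holds_all l' v.
Proof.
elim: k l => [|k IH] l okl.
  exists l => // v; split=> [[v' [e]]|]; last by exists v.
  by have -> : v' = v by apply: funext => j; apply: e.
have [l1 okl1 h1] := fourier_motzkin k okl.
have [l' okl' h'] := IH _ okl1; exists l' => // v; rewrite -h'; split.
  move=> [v' [e hv']]; exists (upd v' k (v k)); split.
    by move=> j; rewrite leq_eqVlt /upd eq_sym; case: eqP => [->//|_]; apply: e.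
  apply/h1; exists (v' k); rewrite upd_upd.
  suff -> : upd v' k (v' k) = v' by [].
  by apply: funext => j; rewrite /upd; case: eqP => [->|].
move=> [v' [e /h1[z hz]]]; exists (upd v' k z); split=> // j kj.
by rewrite /upd gtn_eqF // e // ltnW.
Qed.

(** Once sorted, each literal either ignores coordinate [i] or bounds it from one side. *)
Lemma literals_convex i l v x y z : literals l ->
  holds_all l (upd v i x) -> holds_all l (upd v i z) ->
  slt x y -> slt y z -> holds_all l (upd v i y).
Proof.
move=> /(sort_literals i)[ind [lo [up [_ _ _ h]]]] /h[hi [hl _]] /h[_ [_ hu]] xy yz.
apply/h; split=> //; split=> c cl.
  have := hl _ cl; case: c.1 => /= cx; first exact: (slt_trans ordM cx).
  exact: (slt_asym ordM (le_slt_trans ordM cx xy)).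
have := hu _ cl; case: c.1 => /= cx; first exact: (slt_trans ordM yz).
exact: (slt_asym ordM (slt_le_trans ordM yz cx)).
Qed.

(** Quantifier elimination in semantic form: no formula is built, there is only a finite list of
    literals whose truth values decide [P]. One implication suffices because agreement is symmetric
    in [v] and [v']. *)
Definition determined (P : env -> Prop) := exists2 l, literals l &
  forall v v', (forall c, List.In c l -> (holds c v <-> holds c v')) -> P v -> P v'.

Lemma determined_lt t s : is_term t -> is_term s -> determined (fun v => slt (t v) (s v)).
Proof.
move=> tt ts; exists [:: (true, (t, s))] => [c [<-|[]]//|v v' h].
by apply: (proj1 (h (true, (t, s)) _)); left.
Qed.

Lemma determined_not P : determined P -> determined (fun v => ~ P v).
Proof.
move=> [l okl h]; exists l => // v v' e nP Pv'; apply: nP; apply: h Pv' => c cl.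
by split=> /(e _ cl).
Qed.

Lemma determined_and P Q : determined P -> determined Q -> determined (fun v => P v /\ Q v).
Proof.
move=> [l okl h] [l1 okl1 h1]; exists (l ++ l1); first exact/In_cat_all.
by move=> v v' /In_cat_all[e e1] [Pv Qv]; split; [apply: h Pv|apply: h1 Qv].
Qed.

Definition negate (c : literal) : literal := (~~ c.1, (c.2.2, c.2.1)).

Lemma holds_negate c v : holds (negate c) v <-> ~ holds c v.
Proof. by rewrite /holds /negate; case: c => -[] [t s] /=; rewrite ?notK. Qed.

Fixpoint sign_patterns (l : seq literal) : seq (seq literal) :=
  if l is c :: l' then
    List.map (cons c) (sign_patterns l') ++ List.map (cons (negate c)) (sign_patterns l')
  else [:: [::]].

Lemma literals_pattern l p : literals l -> List.In p (sign_patterns l) -> literals p.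
Proof.
elim: l p => [|c l IH] p /=; first by move=> _ [<-|[]].
rewrite {1}/literals In_cons_all => -[[t1 t2] okl].
by move=> /List.in_app_iff[] /List.in_map_iff[q [<- /(IH _ okl) okq]]; apply/In_cons_all.
Qed.

Lemma pattern_exists l v : exists2 p, List.In p (sign_patterns l) & holds_all p v.
Proof.
elim: l => [|c l [p pl hp]] /=; first by exists [::]; [left|].
have [hc|hc] := pselect (holds c v).
  exists (c :: p); last exact/In_cons_all.
  by apply/List.in_app_iff; left; apply/List.in_map_iff; exists p.
exists (negate c :: p); last by apply/In_cons_all; split=> //; apply/holds_negate.
by apply/List.in_app_iff; right; apply/List.in_map_iff; exists p.
Qed.

Lemma pattern_same l p v v' : List.In p (sign_patterns l) -> holds_all p v -> holds_all p v' ->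
  forall c, List.In c l -> (holds c v <-> holds c v').
Proof.
elim: l p => [|c l IH] p //= /List.in_app_iff[] /List.in_map_iff[q [<- ql]];
  rewrite /holds_all !In_cons_all => -[h1 hq] [h2 hq'];
  split; try exact: IH ql hq hq'; first by split.
by split=> h; [case: (proj1 (holds_negate _ _) h1)|case: (proj1 (holds_negate _ _) h2)].
Qed.

(** For each sign pattern of the literals of [P], the existence of a [z] realising it is a
    conjunction of literals. The literals of all these conjunctions, taken together, transfer the
    pattern of a witness from [v] to [v'], and the pattern decides [P]. *)
Lemma determined_ex i P : determined P -> determined (fun v => exists z, P (upd v i z)).
Proof.
move=> [l okl h]; have [s oks hs] : exists2 s : seq (seq literal),
    (forall q, List.In q s -> literals q) &
    forall p, List.In p (sign_patterns l) -> exists2 q, List.In q s &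
      forall v, (exists z, holds_all p (upd v i z)) <-> holds_all q v.
  have := fun p => @literals_pattern l p okl.
  elim: (sign_patterns l) => [|p ps IH] okps.
    by exists [::].
  have /IH[s oks hs] : forall q, List.In q ps -> literals q by move=> q qps; apply: okps; right.
  have [q okq hq] := fourier_motzkin i (okps p (or_introl erefl)).
  exists (q :: s); first by move=> ? [<-//|/oks].
  by move=> p' [<-|/hs[q' ?]]; [exists q => //; left|exists q' => //; right].
exists (List.concat s); first by move=> c /List.in_concat[q [/oks okq]]; apply: okq.
move=> v v' e [z Pz]; have [p pl hp] := pattern_exists l (upd v i z).
have [q qs hq] := hs p pl.
have /hq[z' hz'] : holds_all q v'.
  move=> c cq; apply/(e c); first by apply/List.in_concat; exists q.
  by move: c cq; apply/hq; exists z.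
by exists z'; apply: h Pz; apply: pattern_same pl hp hz'.
Qed.

Lemma determined_sat (T : theory) (f : formula M) :
    (forall t, term_ok T t -> is_term (fun v => eval v t)) ->
  form_ok T f -> determined (fun v => sat v f).
Proof.
move=> tT; have ext P Q : (forall v, P v <-> Q v) -> determined P -> determined Q.
  by move=> PQ; congr determined; apply: funext => v; apply/propext.
elim: f => [||t s|t s|f IH|f IHf g IHg|f IHf g IHg|i f IH|i f IH] /=.
- by exists [::].
- by exists [::].
- move=> /andP[/tT tt /tT ts].
  apply: ext (determined_and (determined_not (determined_lt tt ts))
                             (determined_not (determined_lt ts tt))) => v.
  split=> [[h1 h2]|->]; first by have [|[]] := slt_total ordM (eval v t) (eval v s).
  by split; apply: (slt_irr ordM).
- by move=> /andP[/tT tt /tT ts]; apply: determined_lt.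
- by move=> /IH; apply: determined_not.
- by move=> /andP[/IHf ? /IHg ?]; apply: determined_and.
- move=> /andP[/IHf df /IHg dg].
  apply: ext (determined_not (determined_and (determined_not df) (determined_not dg))) => v.
  by rewrite not_andE !notK.
- by move=> /IH; apply: determined_ex.
- move=> /IH df; apply: ext (determined_not (determined_ex i (determined_not df))) => v.
  by split=> [h a|h [a]//]; apply: contrapT => na; apply: h; exists a.
Qed.

End Elimination.

(** * Variable assignments and equationally definable relations *)

Section Environments.
Variables (M : Type) (n m : nat).

Lemma env1_ord (a : n.-tuple M) r (i : 'I_n) : env1 a r i = tnth a i.
Proof. by rewrite /env1 ltn_ord (tnth_nth (r i)). Qed.

Lemma env2_left (a : n.-tuple M) (b : m.-tuple M) r (i : 'I_n) : env2 a b r i = tnth a i.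
Proof. by rewrite /env2 ltn_ord (tnth_nth (r i)). Qed.

Lemma env2_right (a : n.-tuple M) (b : m.-tuple M) r (j : 'I_m) :
  env2 a b r (n + j) = tnth b j.
Proof.
by rewrite /env2 ltnNge leq_addr ltn_add2l ltn_ord addKn (tnth_nth (r (n + j))).
Qed.

Lemma env2_cases r (i : nat) :
  [\/ exists k : 'I_n, forall a (b : m.-tuple M), env2 a b r i = tnth a k,
      exists k : 'I_m, forall (a : n.-tuple M) b, env2 a b r i = tnth b k |
      forall (a : n.-tuple M) (b : m.-tuple M), env2 a b r i = r i].
Proof.
have [ni|ni] := ltnP i n.
  by constructor 1; exists (Ordinal ni) => a b; rewrite -(env2_left a b r).
have [nmi|nmi] := ltnP i (n + m); last first.
  by constructor 3 => a b; rewrite /env2 ltnNge ni ltnNge nmi.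
have im : i - n < m by rewrite ltn_subLR.
constructor 2; exists (Ordinal im) => a b.
by rewrite -(env2_right a b r) /= subnKC.
Qed.
End Environments.

Lemma tame_eq_definable (T : theory) (M : lstruct) n m :
    inhabited M ->
    (forall r t s, term_ok T t -> term_ok T s ->
      tame (fun (a : n.-tuple M) (b : m.-tuple M) => eval (env2 a b r) t = eval (env2 a b r) s)) ->
  forall Z : n.-tuple M -> m.-tuple M -> Prop, eq_definable2 T Z -> tame Z.
Proof.
move=> [z0] hT Z [f [okf [ef hf]]].
have : tame (fun (a : n.-tuple M) (b : m.-tuple M) => sat (env2 a b (fun=> z0)) f).
  elim: f {hf} okf ef => [||t s|t s|f IH|f IHf g IHg|f IHf g IHg|i f IH|i f IH] //=.
  - by move=> _ _; apply: (tame_left (fun=> True)).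
  - by move=> _ _; apply: (tame_left (fun=> False)).
  - by move=> /andP[? ?] _; apply: hT.
  - by move=> okf ef; apply: (tame_not (IH okf ef)).
  - by move=> /andP[? ?] /andP[? ?]; apply: tame_and; [apply: IHf|apply: IHg].
  - by move=> /andP[? ?] /andP[? ?]; apply: tame_or; [apply: IHf|apply: IHg].
by congr tame; do 2 apply: funext => ?; apply/propext; symmetry; apply: hf.
Qed.

(** * Order types and half graphs in a dense order *)

Lemma increasing_between (M : lstruct) (lo hi : M) : dense_unbounded_order M -> slt lo hi ->
  exists c : nat -> M, (forall i, slt lo (c i) /\ slt (c i) hi) /\
    forall i j, i < j -> slt (c i) (c j).
Proof.
move=> ordM lohi.
have [f fP] : {f : M -> M & forall x, slt x hi -> slt x (f x) /\ slt (f x) hi}.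
  apply: (@choice _ _ (fun x y => slt x hi -> slt x y /\ slt y hi)) => x.
  have [/(slt_dense ordM)[y]|nx] := pselect (slt x hi); first by exists y.
  by exists x.
pose c i := iter i.+1 f lo; have cP i : slt lo (c i) /\ slt (c i) hi.
  elim: i => [|i [h1 h2]]; first exact: fP.
  by have [h3 h4] := fP _ h2; split=> //; apply: (slt_trans ordM h1).
exists c; split=> //; apply: (homo_ltn (r := @slt M)).
  by move=> y x z; apply: slt_trans.
by move=> i; case: (fP (c i)) => //; case: (cP i).
Qed.

(** Even and odd terms of one monotone sequence, since [2s < 2t + 1] exactly when [s <= t]. For the
    other value of [o] the sequence decreases. *)
Lemma interleaved (M : lstruct) (lo hi : M) (o : bool) : dense_unbounded_order M -> slt lo hi ->
  exists e d : nat -> M, [/\ forall s, slt lo (e s) /\ slt (e s) hi,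
    forall t, slt lo (d t) /\ slt (d t) hi &
    forall s t, if (s <= t) == o then slt (e s) (d t) else slt (d t) (e s)].
Proof.
case: o => ordM lohi.
  have [c [cb cm]] := increasing_between ordM lohi.
  exists (fun s => c s.*2), (fun t => c t.*2.+1); split=> // s t; rewrite eqb_id.
  by case: leqP => st; apply: cm; rewrite ?ltnS ?leq_double // ltn_Sdouble.
have [c [cb cm]] := @increasing_between (dual_order M) hi lo (dual_dense_unbounded ordM) lohi.
exists (fun s => c s.*2), (fun t => c t.*2.+1); split=> [s|t|s t].
- by case: (cb s.*2).
- by case: (cb t.*2.+1).
by rewrite eqbF_neg -ltnNge; case: ltnP => st; apply: cm; rewrite ?ltnS ?leq_double // ltn_Sdouble.
Qed.

Section StableOrder.
Variables (M : lstruct) (n m c : nat) (cst : 'I_c -> M).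
Hypothesis ordM : dense_unbounded_order M.

Definition point := ('I_n + 'I_m + 'I_c)%type.

Definition pt (z : n.-tuple M * m.-tuple M) (k : point) : M :=
  match k with inl (inl i) => tnth z.1 i | inl (inr j) => tnth z.2 j | inr e => cst e end.

Definition in_x (k : point) := if k is inl (inl _) then true else false.
Definition in_y (k : point) := if k is inl (inr _) then true else false.
Definition pure (k k' : point) := ~~ (in_y k || in_y k') || ~~ (in_x k || in_x k').

Definition same_pure_order z z' := forall k k', pure k k' ->
  (slt (pt z k) (pt z k') <-> slt (pt z' k) (pt z' k')).
Definition same_equalities z z' := forall k k', pt z k = pt z k' <-> pt z' k = pt z' k'.
Definition same_order z z' := forall k k',
  (slt (pt z k) (pt z k') <-> slt (pt z' k) (pt z' k')).

Definition reversed z z' : {set point * point} :=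
  [set p | `[< slt (pt z p.1) (pt z p.2) /\ slt (pt z' p.2) (pt z' p.1) >]].

Definition gap z (p : point * point) :=
  #|[set k | `[< slt (pt z p.1) (pt z k) /\ slt (pt z k) (pt z p.2) >]]|.

Lemma reversedP z z' p : reflect (slt (pt z p.1) (pt z p.2) /\ slt (pt z' p.2) (pt z' p.1))
  (p \in reversed z z').
Proof. by rewrite inE; apply: asboolP. Qed.

Lemma reversed0_same_order z z' : same_equalities z z' -> reversed z z' = set0 -> same_order z z'.
Proof.
move=> eqz r0; have nr k k' : slt (pt z k) (pt z k') -> slt (pt z' k') (pt z' k) -> False.
  by move=> h h'; have := in_set0 (k, k'); rewrite -r0 => /reversedP; apply.
move=> k k'; split=> h.
  have [//|[/eqz e|/(nr _ _ h)//]] := slt_total ordM (pt z' k) (pt z' k').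
  by move: h; rewrite e => /(slt_irr ordM).
have [//|[/eqz e|/nr/(_ h)//]] := slt_total ordM (pt z k) (pt z k').
by move: h; rewrite e => /(slt_irr ordM).
Qed.

(** Choose a reversed pair of least gap. A value [k] in between would, wherever it lies in [z'],
    form a reversed pair of smaller gap with [p.1] or with [p.2]. *)
Lemma adjacent_reversed z z' : reversed z z' != set0 -> exists p, p \in reversed z z' /\
  forall k, ~ (slt (pt z p.1) (pt z k) /\ slt (pt z k) (pt z p.2)).
Proof.
move=> /set0Pn[p0 p0r]; have [p pr pmin] := arg_minnP (gap z) p0r.
exists p; split=> // k [k1 k2]; have [h h'] := reversedP _ _ _ pr.
have smaller q : q \in reversed z z' ->
    (forall l, slt (pt z q.1) (pt z l) /\ slt (pt z l) (pt z q.2) ->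
      slt (pt z p.1) (pt z l) /\ slt (pt z l) (pt z p.2)) ->
    ~ (slt (pt z q.1) (pt z k) /\ slt (pt z k) (pt z q.2)) -> False.
  move=> /pmin + sub nk; apply/negP; rewrite -ltnNge; apply: proper_card.
  apply/properP; split; first by apply/subsetP => l; rewrite !inE => /asboolP/sub/asboolP.
  by exists k; rewrite inE; apply/asboolP.
have [k1'|k1'] := pselect (slt (pt z' k) (pt z' p.1)).
  apply: (smaller (p.1, k)) => /=; first exact/reversedP.
    by move=> l [l1 l2]; split=> //; apply: (slt_trans ordM l2 k2).
  by move=> [_ /(slt_irr ordM)].
apply: (smaller (k, p.2)) => /=.
- by apply/reversedP; split=> //=; apply: (slt_le_trans ordM h' k1').
- by move=> l [l1 l2]; split=> //; apply: (slt_trans ordM k1 l1).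
- by move=> [/(slt_irr ordM)].
Qed.

Section Move.
Variables (z : n.-tuple M * m.-tuple M) (alpha beta : M).
(** When [alpha] occurs only among coordinates of [x] and [beta] only among those of [y], this
    replacement of values is carried out by changing the two tuples independently, which a half
    graph demands. *)
Definition relabel (e d u : M) : M :=
  if `[< u = alpha >] then e else if `[< u = beta >] then d else u.

Definition moved_x (e : M) : n.-tuple M :=
  [tuple if `[< tnth z.1 i = alpha >] then e else tnth z.1 i | i < n].
Definition moved_y (d : M) : m.-tuple M :=
  [tuple if `[< tnth z.2 j = beta >] then d else tnth z.2 j | j < m].

Hypothesis alpha_x : forall k, pt z k = alpha -> in_x k.
Hypothesis beta_y : forall k, pt z k = beta -> in_y k.

Lemma pt_moved e d k : pt (moved_x e, moved_y d) k = relabel e d (pt z k).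
Proof.
case: k => [[i|j]|k] /=; rewrite /relabel ?tnth_mktuple.
- by case: asboolP => // _; case: asboolP => // /(beta_y (k := inl (inl i))).
- by case: (asboolP (_ = alpha)) => // /(alpha_x (k := inl (inr j))).
case: asboolP => [/(alpha_x (k := inr k))//|_].
by case: asboolP => [/(beta_y (k := inr k))//|_].
Qed.

Variables (lo hi : M).
Hypothesis lohi : slt lo hi.
Hypothesis ends : (alpha = lo /\ beta = hi) \/ (alpha = hi /\ beta = lo).
Hypothesis no_between : forall k, ~ (slt lo (pt z k) /\ slt (pt z k) hi).
Variables (e d : M).
Hypothesis e_between : slt lo e /\ slt e hi.
Hypothesis d_between : slt lo d /\ slt d hi.

Lemma relabel_ends : (relabel e d lo = e /\ relabel e d hi = d) \/
                     (relabel e d lo = d /\ relabel e d hi = e).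
Proof.
have nlh : lo <> hi by move=> E; move: lohi; rewrite E => /(slt_irr ordM).
rewrite /relabel; case: ends => -[-> ->]; [left|right];
by rewrite (asboolF nlh) (asboolF (nesym nlh)) !(asboolT erefl).
Qed.

Lemma relabel_id u : u <> lo -> u <> hi -> relabel e d u = u.
Proof.
by move=> u1 u2; rewrite /relabel; case: ends => -[-> ->]; case: asboolP => // _; case: asboolP.
Qed.

Lemma relabel_between u : u = lo \/ u = hi -> slt lo (relabel e d u) /\ slt (relabel e d u) hi.
Proof. by case=> ->; case: relabel_ends => -[e1 e2]; rewrite ?e1 ?e2. Qed.

(** Moved values stay strictly between [lo] and [hi] and every other value lies outside that
    interval, so only [lo] and [hi] themselves can change their order. *)
Lemma relabel_lt k k' : slt (pt z k) (pt z k') -> ~ (pt z k = lo /\ pt z k' = hi) ->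
  slt (relabel e d (pt z k)) (relabel e d (pt z k')).
Proof.
move: (pt z k) (pt z k') (no_between (k := k)) (no_between (k := k')) => u w nu nw uw ne.
have [u1|u1] := pselect (u = lo \/ u = hi); have [w1|w1] := pselect (w = lo \/ w = hi).
- by case: u1 => E1; case: w1 => E2; move: uw; rewrite E1 E2;
    [move/(slt_irr ordM)|case: ne|move/(slt_asym ordM lohi)|move/(slt_irr ordM)].
- have [_ h] := relabel_between u1; apply: (slt_trans ordM h).
  rewrite relabel_id; [|tauto|tauto].
  have lw : slt lo w by case: u1 uw => -> // /(slt_trans ordM lohi).
  by have [//|[/esym E|hw]] := slt_total ordM hi w; [case: w1; right|case: nw].
- have [h _] := relabel_between w1; apply: (fun h' => slt_trans ordM h' h).
  rewrite relabel_id; [|tauto|tauto].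
  have lu : slt u hi by case: w1 uw => -> // /(slt_trans ordM)/(_ lohi).
  by have [//|[E|hw]] := slt_total ordM u lo; [case: u1; left|case: nu].
by rewrite !relabel_id //; tauto.
Qed.

End Move.

Lemma same_equalities_of_lt z z' :
  (forall k k', pt z k = pt z k' -> pt z' k = pt z' k') ->
  (forall k k', slt (pt z k) (pt z k') -> pt z' k <> pt z' k') -> same_equalities z z'.
Proof.
move=> h1 h2 k k'; split=> [/h1//|e].
have [/h2//|[//|/h2]] := slt_total ordM (pt z k) (pt z k').
by rewrite e.
Qed.

(** Pure comparisons and equalities agree in [z] and [z'], so a reversed pair is mixed, and so is
    every pair of indices with the same two values. Hence one end of the gap is taken only by
    coordinates of [x] and the other only by coordinates of [y]. Both ends can be moved into the
    gap, in the old order or in the exchanged one. *)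
Lemma adjacent_move z z' p :
    same_pure_order z z' -> same_equalities z z' -> p \in reversed z z' ->
    (forall k, ~ (slt (pt z p.1) (pt z k) /\ slt (pt z k) (pt z p.2))) ->
  exists (o : bool) (ma : M -> n.-tuple M) (mb : M -> m.-tuple M), forall e d,
    slt (pt z p.1) e /\ slt e (pt z p.2) -> slt (pt z p.1) d /\ slt d (pt z p.2) ->
    (if o then slt e d else slt d e) ->
      same_order z (ma e, mb d) /\
      [/\ same_pure_order (ma d, mb e) z', same_equalities (ma d, mb e) z' &
           #|reversed (ma d, mb e) z'| < #|reversed z z'|].
Proof.
move=> pure_zz' eq_zz' pr nb; have [lohi hilo'] := reversedP _ _ _ pr.
set lo := pt z p.1 in lohi nb *; set hi := pt z p.2 in lohi nb *.
have not_pure : ~~ pure p.1 p.2.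
  by apply/negP => /pure_zz'[/(_ lohi)/(slt_asym ordM)].
have at_lo k : pt z k = lo -> ~~ pure k p.2.
  move=> kl; apply/negP => /pure_zz'[h _]; apply: (slt_asym ordM hilo').
  by rewrite -(proj1 (eq_zz' k p.1) kl); apply: h; rewrite kl.
have at_hi k : pt z k = hi -> ~~ pure p.1 k.
  move=> kh; apply/negP => /pure_zz'[h _]; apply: (slt_asym ordM hilo').
  by rewrite -(proj1 (eq_zz' k p.2) kh); apply: h; rewrite kh.
have [alpha [beta [ends alpha_x beta_y]]] : exists alpha beta,
    [/\ (alpha = lo /\ beta = hi) \/ (alpha = hi /\ beta = lo),
        forall k, pt z k = alpha -> in_x k & forall k, pt z k = beta -> in_y k].
  have x_of k k' : ~~ pure k k' -> in_y k' -> in_x k.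
    by rewrite /pure; case: k k' => [[?|?]|?] [[?|?]|?].
  have y_of k k' : ~~ pure k k' -> in_x k' -> in_y k.
    by rewrite /pure; case: k k' => [[?|?]|?] [[?|?]|?].
  have pureC k k' : pure k k' = pure k' k
    by rewrite /pure [in_y k || _]orbC [in_x k || _]orbC.
  have [[px py]|[px py]] : (in_x p.1 /\ in_y p.2) \/ (in_y p.1 /\ in_x p.2).
    by move: not_pure; rewrite /pure; case: p.1 p.2 => [[?|?]|?] [[?|?]|?] //=; tauto.
  - exists lo, hi; split; first by left.
      by move=> k /at_lo/x_of; apply.
    by move=> k /at_hi; rewrite pureC => /y_of; apply.
  - exists hi, lo; split; first by right.
      by move=> k /at_hi; rewrite pureC => /x_of; apply.
    by move=> k /at_lo/y_of; apply.
pose w e d := (moved_x z alpha e, moved_y z beta d).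
have wE e d k : pt (w e d) k = relabel alpha beta e d (pt z k) by apply: pt_moved.
have mixed k k' : pt z k = lo -> pt z k' = hi -> ~~ pure k k' /\ ~~ pure k' k.
  case: ends => -[<- <-]; [move=> /alpha_x + /beta_y|move=> /beta_y + /alpha_x];
  by rewrite /pure; case: k k' => [[?|?]|?] [[?|?]|?].
have btw := relabel_lt lohi ends nb.
have lt_w e d : slt lo e /\ slt e hi -> slt lo d /\ slt d hi -> forall k k',
    slt (pt z k) (pt z k') -> ~ (pt z k = lo /\ pt z k' = hi) ->
    slt (pt (w e d) k) (pt (w e d) k').
  by move=> he hd k k' h1 h2; rewrite !wE; apply: btw.
have eq_w e d : slt lo e /\ slt e hi -> slt lo d /\ slt d hi -> e <> d ->
    same_equalities z (w e d).
  move=> he hd ed; apply: same_equalities_of_lt => k k' kk'; first by rewrite !wE kk'.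
  have [[kl kh]|nlh] := pselect (pt z k = lo /\ pt z k' = hi).
    rewrite !wE kl kh; have [[-> ->]//|[-> ->]] := relabel_ends lohi ends e d.
    by move=> /esym.
  by move=> E; have := lt_w e d he hd k k' kk' nlh; rewrite E => /(slt_irr ordM).
have pure_w e d : slt lo e /\ slt e hi -> slt lo d /\ slt d hi -> e <> d ->
    same_pure_order (w e d) z.
  move=> he hd ed k k' kk'; split=> h.
    have [//|[/(eq_w e d he hd ed) E|h']] := slt_total ordM (pt z k) (pt z k').
      by move: h; rewrite E => /(slt_irr ordM).
    case: (slt_asym ordM h); apply: lt_w => // -[kl kh].
    by have [_] := mixed _ _ kl kh; rewrite kk'.
  apply: lt_w => // -[kl kh].
  by have [+ _] := mixed _ _ kl kh; rewrite kk'.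
have same_w e d : slt lo e /\ slt e hi -> slt lo d /\ slt d hi ->
    slt (relabel alpha beta e d lo) (relabel alpha beta e d hi) -> same_order z (w e d).
  move=> he hd ed; have lt1 k k' : slt (pt z k) (pt z k') -> slt (pt (w e d) k) (pt (w e d) k').
    have [[kl kh] _|nlh h] := pselect (pt z k = lo /\ pt z k' = hi).
      by rewrite !wE kl kh.
    exact: lt_w.
  move=> k k'; split=> [/lt1//|h].
  have [//|[E|/lt1/(slt_asym ordM h)//]] := slt_total ordM (pt z k) (pt z k').
  by move: h; rewrite !wE E => /(slt_irr ordM).
have fewer e d : slt lo e /\ slt e hi -> slt lo d /\ slt d hi ->
    slt (relabel alpha beta e d hi) (relabel alpha beta e d lo) ->
    #|reversed (w e d) z'| < #|reversed z z'|.
  move=> he hd de; have ed : e <> d.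
    by move=> E; move: de; rewrite E; have [[-> ->]|[-> ->]] := relabel_ends lohi ends d d;
      move/(slt_irr ordM).
  apply: proper_card; apply/properP; split; last first.
    exists p => //; apply/negP => /reversedP[h _]; apply: (slt_asym ordM h).
    by rewrite !wE.
  apply/subsetP => q /reversedP[h h']; apply/reversedP; split=> //.
  have [//|[/(eq_w e d he hd ed) E|h1]] := slt_total ordM (pt z q.1) (pt z q.2).
    by move: h; rewrite E => /(slt_irr ordM).
  have [[q2 q1]|nlh] := pselect (pt z q.2 = lo /\ pt z q.1 = hi).
    move: h'; rewrite (proj1 (eq_zz' q.2 p.1) q2) (proj1 (eq_zz' q.1 p.2) q1).
    by move/(slt_asym ordM hilo').
  by case: (slt_asym ordM h); apply: lt_w.
have trans_pure e d : same_pure_order (w e d) z -> same_pure_order (w e d) z'.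
  by move=> h k k' kk'; rewrite (h k k' kk') (pure_zz' k k' kk').
have trans_eq e d : same_equalities z (w e d) -> same_equalities (w e d) z'.
  by move=> h k k'; rewrite -(h k k') (eq_zz' k k').
have neq_lt (e d : M) : slt e d -> e <> d /\ d <> e.
  by move=> h; split=> E; move: h; rewrite E => /(slt_irr ordM).
(* [o] records whether the value moved through [x] is the lower end of the gap. *)
exists `[< alpha = lo >], (moved_x z alpha), (moved_y z beta) => e d he hd.
have nlh : lo <> hi by move=> E; move: lohi; rewrite E => /(slt_irr ordM).
have [[al be]|[al be]] := ends; rewrite al.
  rewrite (asboolT erefl) => ed; have [ed1 ed2] := neq_lt _ _ ed.
  have rl u v : relabel alpha beta u v lo = u /\ relabel alpha beta u v hi = v.
    by rewrite /relabel al be (asboolF (nesym nlh)) !(asboolT erefl).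
  split; first by rewrite -al; apply: same_w => //; case: (rl e d) => -> ->.
  rewrite -al; split; [exact/trans_pure/pure_w|exact/trans_eq/eq_w|].
  by apply: fewer => //; case: (rl d e) => -> ->.
rewrite (asboolF (nesym nlh)) => ed; have [ed1 ed2] := neq_lt _ _ ed.
have rl u v : relabel alpha beta u v lo = v /\ relabel alpha beta u v hi = u.
  by rewrite /relabel al be (asboolF nlh) !(asboolT erefl).
split; first by rewrite -al; apply: same_w => //; case: (rl e d) => -> ->.
rewrite -al; split; [exact/trans_pure/pure_w|exact/trans_eq/eq_w|].
by apply: fewer => //; case: (rl d e) => -> ->.
Qed.

(** Induction on the number of reversed pairs. Inside an adjacent reversed gap, [D] has its value at
    [z] when the moved ends keep their order and, by induction, its value at [z'] when they are
    exchanged. If these differ, interleaving positions yield a half graph. *)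
Lemma stable_same_order (D : n.-tuple M -> m.-tuple M -> Prop) : stable2 D ->
    (forall z z', same_order z z' -> D z.1 z.2 -> D z'.1 z'.2) ->
  forall z z', same_pure_order z z' -> same_equalities z z' -> (D z.1 z.2 <-> D z'.1 z'.2).
Proof.
move=> stD resp; have sym z z' : same_order z z' -> same_order z' z.
  by move=> h k k'; rewrite (h k k').
have respE z z' : same_order z z' -> (D z.1 z.2 <-> D z'.1 z'.2).
  by move=> h; split; apply: resp => //; apply: sym.
move=> z z'; have [N] := ubnP #|reversed z z'|.
elim: N z => // N IH z ltN pz ez.
have [r0|/adjacent_reversed[p [pr nb]]] := eqVneq (reversed z z') set0.
  exact/respE/reversed0_same_order.
have [o [ma [mb h]]] := adjacent_move pz ez pr nb.
have [lohi _] := reversedP _ _ _ pr.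
have keep e d : slt (pt z p.1) e /\ slt e (pt z p.2) -> slt (pt z p.1) d /\ slt d (pt z p.2) ->
    (if o then slt e d else slt d e) -> (D (ma e) (mb d) <-> D z.1 z.2).
  by move=> he hd ed; have [/respE-> _] := h _ _ he hd ed.
have flip e d : slt (pt z p.1) e /\ slt e (pt z p.2) -> slt (pt z p.1) d /\ slt d (pt z p.2) ->
    (if o then slt d e else slt e d) -> (D (ma e) (mb d) <-> D z'.1 z'.2).
  move=> he hd ed; case: (h _ _ hd he ed) => _ [pw ew lt].
  exact: (IH _ (leq_trans lt ltN) pw ew).
have [Dz|nDz] := pselect (D z.1 z.2); have [Dz'|nDz'] := pselect (D z'.1 z'.2) => //.
  case: stD; have [e [d [eb db ed]]] := interleaved o ordM lohi.
  exists (ma \o e), (mb \o d) => s t /=; have := ed s t.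
  case: leqP => st /=.
    move=> E; split=> // _; apply/keep => //; move: E; by case: (o).
  move=> E; split=> // /flip h'; case: nDz'; apply: h' => //; move: E; by case: (o).
(* Now [D] holds only after the exchange, so [s <= t] must correspond to the exchanged order. *)
case: stD; have [e [d [eb db ed]]] := interleaved (~~ o) ordM lohi.
exists (ma \o e), (mb \o d) => s t /=; have := ed s t.
case: leqP => st /=.
  move=> E; split=> // _; apply/flip => //; move: E; by case: (o).
move=> E; split=> // /keep h'; case: nDz; apply: h' => //; move: E; by case: (o).
Qed.
End StableOrder.

(** * The equivalence for dense linear orders *)

Section DenseLinearOrders.
Variable M : lstruct.
Hypothesis modM : models DLO M.

Lemma dlo_dense_unbounded : dense_unbounded_order M.
Proof. by case: modM => inh [[irr [tr tot]] [de [lo hi]]]; split=> // b a c; apply: tr. Qed.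
Let ordM := dlo_dense_unbounded.

Definition dlo_term (t : (nat -> M) -> M) :=
  (exists j, t = fun v => v j) \/ (exists a, t = fun=> a).

Lemma dlo_solve i t s : dlo_term t -> dlo_term s -> solvable dlo_term i t s.
Proof.
have [z0] := slt_inhabited ordM.
have indepV j : j <> i -> indep i (fun v : nat -> M => v j).
  by move=> ji v z; rewrite /upd; case: eqP.
have termV j : dlo_term (fun v => v j) by left; exists j.
have termC a : dlo_term (fun=> a) by right; exists a.
have indepC (a : M) : indep i (fun=> a) by [].
have refl t' s' : equi_sign t' s' t' s' by [].
have no_var t' s' : dlo_term t' -> dlo_term s' -> indep i t' -> indep i s' ->
    solvable dlo_term i t' s'.
  by move=> ? ? ? ?; constructor 1; exists t', s'.
move=> [[j ->]|[a ->]] [[k ->]|[b ->]].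
- have [->|ji] := pselect (j = i); have [->|ki] := pselect (k = i).
  (* Comparing variable [i] with itself amounts to comparing any constant with itself. *)
  + constructor 1; exists (fun=> z0), (fun=> z0); split=> // v.
    by split; split=> /(slt_irr ordM).
  + by constructor 2; exists (fun v => v k); split=> //; apply: indepV.
  + by constructor 3; exists (fun v => v j); split=> //; apply: indepV.
  + by apply: no_var => //; apply: indepV.
- have [->|ji] := pselect (j = i); last by apply: no_var => //; apply: indepV.
  by constructor 2; exists (fun=> b).
- have [->|ki] := pselect (k = i); last by apply: no_var => //; apply: indepV.
  by constructor 3; exists (fun=> a).
- exact: no_var.
Qed.

Lemma dlo_eval (t : term M) : term_ok DLO t -> dlo_term (fun v => eval v t).
Proof. by case: t => // [i|a] _; [left; exists i|right; exists a]. Qed.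

Variables n m : nat.
Implicit Types D Z : n.-tuple M -> m.-tuple M -> Prop.

Lemma dlo_tame Z : eq_definable2 DLO Z -> tame Z.
Proof.
apply: tame_eq_definable; first exact: slt_inhabited.
move=> r t s /dlo_eval tt /dlo_eval ts.
have side u : dlo_term (fun v => eval v u) ->
    (exists f, forall (a : n.-tuple M) (b : m.-tuple M), eval (env2 a b r) u = f a) \/
    (exists f, forall (a : n.-tuple M) (b : m.-tuple M), eval (env2 a b r) u = f b).
  move=> [[j E]|[c E]]; last first.
    by left; exists (fun=> c) => a b; rewrite (congr1 (@^~ (env2 a b r)) E).
  have [[k kP]|[k kP]|kP] := env2_cases n m r j.
  - by left; exists (fun a => tnth a k) => a b; rewrite -(kP a b) (congr1 (@^~ (env2 a b r)) E).
  - by right; exists (fun b => tnth b k) => a b; rewrite -(kP a b) (congr1 (@^~ (env2 a b r)) E).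
  - by left; exists (fun=> r j) => a b; rewrite -(kP a b) (congr1 (@^~ (env2 a b r)) E).
have tame_ext (P Q : n.-tuple M -> m.-tuple M -> Prop) :
    (forall a b, P a b <-> Q a b) -> tame P -> tame Q.
  by move=> PQ; congr tame; do 2 apply: funext => ?; apply/propext.
have [[f fE]|[f fE]] := side t tt; have [[g gE]|[g gE]] := side s ts.
- apply: tame_ext (tame_left (fun a => f a = g a)) => a b; by rewrite fE gE.
- apply: tame_ext (tame_eq f g) => a b; by rewrite fE gE.
- apply: tame_ext (tame_eq g f) => a b; rewrite fE gE; by split.
- apply: tame_ext (tame_right (fun a => f a = g a)) => a b; by rewrite fE gE.
Qed.

Lemma dlo_points D : definable2 DLO D -> exists c (cst : 'I_c -> M),
  forall z z', same_order cst z z' -> D z.1 z.2 -> D z'.1 z'.2.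
Proof.
case=> f [okf fP]; have [z0] := slt_inhabited ordM.
have [l okl lP] := determined_sat ordM dlo_solve dlo_eval okf.
(* The list of constants contains [z0] because variables beyond those of [x] and [y] are assigned
   that value. *)
have [C [C0 hC]] : exists C : seq M, (exists2 i, i < size C & nth z0 C i = z0) /\
    forall c, List.In c l -> forall t, (t = c.2.1 \/ t = c.2.2) ->
      (exists j, t = fun v => v j) \/ exists2 i, i < size C & t = fun=> nth z0 C i.
  elim: l okl {lP} => [|c l IH] okl; first by exists [:: z0]; split=> //; exists 0.
  have /IH[C [[i iC iz] hC]] : literals dlo_term l by move=> x xl; apply: okl; right.
  have [t1 t2] := okl c (or_introl erefl).
  have add (t : (nat -> M) -> M) : dlo_term t ->
      exists a, (exists j, t = fun v => v j) \/ t = fun=> a.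
    by case=> [[j ->]|[a ->]]; [exists z0; left; exists j|exists a; right].
  have [a1 h1] := add _ t1; have [a2 h2] := add _ t2.
  exists [:: a1, a2 & C]; split; first by exists i.+2.
  move=> x [<- t [->|->]|xl t tx].
  - by case: h1 => [|->]; [left|right; exists 0].
  - by case: h2 => [|->]; [left|right; exists 1].
  - by have [|[k kC ->]] := hC x xl t tx; [left|right; exists k.+2].
exists (size C), (fun i => nth z0 C i) => z z' so.
have val c t : List.In c l -> (t = c.2.1 \/ t = c.2.2) ->
    exists k : point n m (size C), forall z : n.-tuple M * m.-tuple M,
      t (env2 z.1 z.2 (fun=> z0)) = pt (fun i : 'I_(size C) => nth z0 C i) z k.
  move=> cl /(hC c cl)[[j ->]|[i iC ->]]; last by exists (inr (Ordinal iC)).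
  have [[k kP]|[k kP]|kP] := env2_cases n m (fun=> z0) j.
  - by exists (inl (inl k)) => x; rewrite kP.
  - by exists (inl (inr k)) => x; rewrite kP.
  - by have [i iC iz] := C0; exists (inr (Ordinal iC)) => x; rewrite kP /= iz.
move=> /(fP _ _ (fun=> z0)) Dz; apply/(fP _ _ (fun=> z0)); apply: lP Dz => -[b [t s]] cl.
have [k kP] := val _ t cl (or_introl erefl); have [k' kP'] := val _ s cl (or_intror erefl).
rewrite /holds /= !kP !kP' /cmp; have h1 := so k k'; have h2 := so k' k.
by case: b {cl} => //; rewrite h2.
Qed.

Lemma dlo_special_union D : definable2 DLO D -> stable2 D -> special_union DLO D.
Proof.
move=> /dlo_points[c [cst resp]] stD.
(* The flag selects equations, allowed for all pairs, or strict comparisons, which are made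
   identically false on mixed pairs. *)
pose A (f : point n m c * point n m c * bool) (a : n.-tuple M) (b : m.-tuple M) :=
  if f.2 then pt cst (a, b) f.1.1 = pt cst (a, b) f.1.2
  else pure f.1.1 f.1.2 /\ slt (pt cst (a, b) f.1.1) (pt cst (a, b) f.1.2).
apply: (special_union_determined (A := A)); last first.
  move=> a b a' b' h.
  apply: (proj1 (stable_same_order ordM stD resp (z := (a, b)) (z' := (a', b')) _ _)) => k k'.
    by move=> kk'; have [h1 h2] := h (k, k', false);
      split=> x; [case: (h1 (conj kk' x))|case: (h2 (conj kk' x))].
  exact: (h (k, k', true)).
pose tm (k : point n m c) : term M :=
  match k with inl (inl i) => TVar i | inl (inr j) => TVar (n + j) | inr e => TPar (cst e) end.
have tmE k a b r : eval (env2 a b r) (tm k) = pt cst (a, b) k.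
  by case: k => [[i|j]|e] //=; [apply: env2_left|apply: env2_right].
have tm_ok k : term_ok DLO (tm k) by case: k => [[i|j]|e].
case=> [[k k'] []]; rewrite /A /=.
  apply/su_special/special_stable_eq; exists (FEq (tm k) (tm k')).
  by rewrite /= !tm_ok; split=> //; split=> // a b r; rewrite !tmE.
have [kk'|nk] := boolP (pure k k'); last first.
  have := @special_union_const DLO M n m False; congr special_union.
  by do 2 apply: funext => ?; apply/propext; split=> // -[].
have left_lt (t s : term M) (f g : n.-tuple M -> M) : term_ok DLO t -> term_ok DLO s ->
    (forall a r, eval (env1 a r) t = f a) -> (forall a r, eval (env1 a r) s = g a) ->
    special_union DLO (fun a (_ : m.-tuple M) => true /\ slt (f a) (g a)).
  move=> okt oks tE sE; apply/su_special/special_stable_left; exists (FLt t s).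
  by rewrite /= okt oks; split=> // a r; rewrite tE sE; split=> // -[].
have right_lt (t s : term M) (f g : m.-tuple M -> M) : term_ok DLO t -> term_ok DLO s ->
    (forall a r, eval (env1 a r) t = f a) -> (forall a r, eval (env1 a r) s = g a) ->
    special_union DLO (fun (_ : n.-tuple M) b => true /\ slt (f b) (g b)).
  move=> okt oks tE sE; apply/su_special/special_stable_right; exists (FLt t s).
  by rewrite /= okt oks; split=> // a r; rewrite tE sE; split=> // -[].
move: kk'; case: k k' => [[i|j]|e] [[i'|j']|e'] // _ /=.
- by apply: (left_lt (TVar i) (TVar i')) => // a r; apply: env1_ord.
- by apply: (left_lt (TVar i) (TPar (cst e'))) => // a r; apply: env1_ord.
- by apply: (right_lt (TVar j) (TVar j')) => // a r; apply: env1_ord.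
- by apply: (right_lt (TVar j) (TPar (cst e'))) => // a r; apply: env1_ord.
- by apply: (left_lt (TPar (cst e)) (TVar i')) => // a r; apply: env1_ord.
- by apply: (right_lt (TPar (cst e)) (TVar j')) => // a r; apply: env1_ord.
- by apply: (left_lt (TPar (cst e)) (TPar (cst e'))).
Qed.

Lemma dlo_special_union_stable D : special_union DLO D -> stable2 D.
Proof. exact/special_union_stable/dlo_tame. Qed.

End DenseLinearOrders.

(** * Divisible ordered groups as rational vector spaces *)

Section OrderedGroups.
Import Order.TTheory GRing.Theory Num.Theory.
Local Open Scope ring_scope.

(** The carrier tagged with the proof that it is a model, so that the algebraic structures built
    from this proof can be attached to it. *)
Definition doag_group (M : lstruct) of models DOAG M : Type := carrier M.

Section GroupStructure.
Variables (M : lstruct) (modM : models DOAG M).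
Notation G := (doag_group modM).

HB.instance Definition _ := gen_eqMixin G.
HB.instance Definition _ := gen_choiceMixin G.

Fact doag_addA : associative (@sadd M : G -> G -> G).
Proof. by have [] := modM. Qed.
Fact doag_addC : commutative (@sadd M : G -> G -> G).
Proof. by have [_ []] := modM. Qed.
Fact doag_add0 : left_id (szero M : G) (@sadd M).
Proof. by have [_ [_ []]] := modM. Qed.
Fact doag_addN : left_inverse (szero M : G) (@sopp M) (@sadd M).
Proof. by have [_ [_ [_ []]]] := modM. Qed.

HB.instance Definition _ := GRing.isZmodule.Build G doag_addA doag_addC doag_add0 doag_addN.

Definition pos (x : G) : Prop := @slt M (0 : G) x.

Lemma slt_pos (x y : G) : @slt M x y <-> pos (y - x).
Proof.
have add (a b c : G) : @slt M a b -> @slt M (a + c : G) (b + c : G).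
  by have [_ [_ [_ [_ [_ [h _]]]]]] := modM; apply: h.
split=> [/(add _ _ (- x))|/(add _ _ x)]; first by rewrite subrr.
by rewrite add0r subrK.
Qed.

Lemma pos_add x y : pos x -> pos y -> pos (x + y).
Proof.
have [_ [_ [_ [_ [[_ [tr _]] _]]]]] := modM; move=> px py.
by apply: (tr _ x) => //; apply/slt_pos; rewrite addrAC subrr add0r.
Qed.

Lemma pos0 : ~ pos 0.
Proof. by have [_ [_ [_ [_ [[irr _] _]]]]] := modM; apply: irr. Qed.

Lemma pos_total (x : G) : pos x \/ x = 0 \/ pos (- x).
Proof.
have [_ [_ [_ [_ [[_ [_ tot]] _]]]]] := modM.
have [|[->|/slt_pos]] := tot (0 : G) x; [by left|by right; left|].
by rewrite sub0r; right; right.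
Qed.

Lemma pos_asym x : pos x -> ~ pos (- x).
Proof. by move=> px /(pos_add px); rewrite subrr => /pos0. Qed.

Lemma pos_mulrn x k : (0 < k)%N -> pos x -> pos (x *+ k).
Proof.
case: k => // k _ px; elim: k => [|k IH]; first by rewrite mulr1n.
by rewrite mulrS; apply: pos_add.
Qed.

Lemma pos_mulrnE x k : (0 < k)%N -> pos (x *+ k) <-> pos x.
Proof.
move=> k0; split; last exact: pos_mulrn.
have [//|[->|/(pos_mulrn k0)]] := pos_total x; first by rewrite mul0rn.
by rewrite mulNrn => h /pos_asym.
Qed.

(** Torsion-freeness, which makes the quotients supplied by divisibility unique. *)
Lemma mulrn_inj k : (0 < k)%N -> injective (fun x : G => x *+ k).
Proof.
move=> k0 x y /eqP; rewrite -subr_eq0 -mulrnBl => /eqP xy; apply/eqP.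
rewrite -subr_eq0; apply/eqP; have [|[//|]] := pos_total (x - y).
  by move/(pos_mulrn k0); rewrite xy => /pos0.
by move/(pos_mulrn k0); rewrite mulNrn xy oppr0 => /pos0.
Qed.

Lemma doag_divisible (x : G) k : (0 < k)%N -> exists y : G, y *+ k = x.
Proof.
have [_ [_ [_ [_ [_ [_ [dv _]]]]]]] := modM => /(dv x)[y <-]; exists y.
by elim: k => //= k <-; rewrite mulrS.
Qed.

Lemma scale_exists : {f : rat -> G -> G & forall q x, f q x *+ `|denq q| = x *~ numq q}.
Proof.
apply: (@choice _ _ (fun q (g : G -> G) => forall x, g x *+ `|denq q| = x *~ numq q)) => q.
have d0 : (0 < `|denq q|)%N by rewrite absz_gt0 denq_neq0.
have [g gP] : {g : G -> G & forall x, g x *+ `|denq q| = x *~ numq q}; last by exists g.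
apply: (@choice _ _ (fun x y : G => y *+ `|denq q| = x *~ numq q)) => x.
exact: doag_divisible.
Qed.

Definition doag_scale : rat -> G -> G := projT1 scale_exists.

(** Any fraction representing [q] may be used, reduced or not; the module axioms can then be checked
    on products and sums of fractions. *)
Lemma doag_scaleP q (x y : G) (p : int) k : (0 < k)%N -> q = p%:~R / k%:R ->
  y *+ k = x *~ p -> doag_scale q x = y.
Proof.
move=> k0 qE ykE; have sE := projT2 scale_exists q x; rewrite -/doag_scale in sE.
have d0 : (0 < `|denq q|)%N by rewrite absz_gt0 denq_neq0.
have cross : numq q * k%:Z = p * denq q.
  have qk : q * k%:R = p%:~R by rewrite qE mulfVK // pnatr_eq0 -lt0n.
  by apply/eqP; rewrite -(eqr_int rat) !rmorphM /= numqE mulrAC -pmulrn qk.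
apply: (@mulrn_inj (`|denq q| * k)%N); first by rewrite muln_gt0 d0.
rewrite /= mulrnA sE mulnC mulrnA ykE !pmulrn -!mulrzA cross.
by rewrite gez0_abs ?denq_ge0.
Qed.


Lemma doag_scaleA a b x : doag_scale a (doag_scale b x) = doag_scale (a * b) x.
Proof.
symmetry; have sa := projT2 scale_exists a (doag_scale b x).
have sb := projT2 scale_exists b x; rewrite -/doag_scale in sa sb.
apply: (@doag_scaleP _ _ _ (numq a * numq b) (`|denq a| * `|denq b|)%N).
- by rewrite muln_gt0 !absz_gt0 !denq_neq0.
- rewrite natrM rmorphM /= invfM mulrACA !(pmulrn _ `|_|) !gez0_abs ?denq_ge0 //.
  by rewrite !divq_num_den.
by rewrite mulrnA sa !pmulrn mulrzAC -pmulrn sb -!mulrzA mulrC.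
Qed.

Lemma doag_scale1 : left_id 1 doag_scale.
Proof. by move=> x; apply: (@doag_scaleP _ _ _ 1 1); rewrite // divr1. Qed.

Lemma doag_scaleDr : right_distributive doag_scale +%R.
Proof.
move=> a x y; apply: (@doag_scaleP _ _ _ (numq a) `|denq a|).
- by rewrite absz_gt0 denq_neq0.
- by rewrite pmulrn gez0_abs ?denq_ge0 // divq_num_den.
by rewrite mulrnDl mulrzDl !(projT2 scale_exists).
Qed.

Lemma doag_scaleDl x : {morph doag_scale^~ x : a b / a + b}.
Proof.
move=> a b; have sa := projT2 scale_exists a x; have sb := projT2 scale_exists b x.
rewrite -/doag_scale in sa sb.
apply: (@doag_scaleP _ _ _ (numq a * denq b + numq b * denq a) (`|denq a| * `|denq b|)%N).
- by rewrite muln_gt0 !absz_gt0 !denq_neq0.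
- rewrite natrM rmorphD !rmorphM /= !(pmulrn _ `|_|) !gez0_abs ?denq_ge0 //.
  have da : (denq a)%:~R != 0 :> rat by rewrite intr_eq0 denq_neq0.
  have db : (denq b)%:~R != 0 :> rat by rewrite intr_eq0 denq_neq0.
  rewrite !numqE; move: da db; set d := _%:~R; set e := _%:~R => da db.
  apply: (mulIf (mulf_neq0 da db)); rewrite mulfVK ?mulf_neq0 //.
  ring.
rewrite mulrnDl mulrnA sa mulnC mulrnA sb !pmulrn !gez0_abs ?denq_ge0 //.
by rewrite -!mulrzA -mulrzDr.
Qed.

HB.instance Definition _ := GRing.Zmodule_isLmodule.Build rat G
  doag_scaleA doag_scale1 doag_scaleDr doag_scaleDl.

Lemma pos_scale (q : rat) (x : G) : 0 < q -> pos x -> pos (q *: x).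
Proof.
move=> q0 px; apply/(@pos_mulrnE _ `|denq q|); first by rewrite absz_gt0 denq_neq0.
rewrite (projT2 scale_exists) -[numq q]gez0_abs; last by rewrite numq_ge0 ltW.
by rewrite -pmulrn; apply: pos_mulrn; rewrite // absz_gt0 gt_eqF // numq_gt0.
Qed.

Lemma pos_scaleE (q : rat) (x : G) : 0 < q -> pos (q *: x) <-> pos x.
Proof.
move=> q0; split; last exact: pos_scale.
by rewrite -{2}[x]scale1r -(mulVf (lt0r_neq0 q0)) -scalerA; apply: pos_scale; rewrite invr_gt0.
Qed.

Lemma doag_dense_unbounded : dense_unbounded_order M.
Proof.
have [_ [_ [_ [_ [[irr [tr tot]] [_ [_ [p pn0]]]]]]]] := modM.
have [e pe] : exists e : G, pos e.
  have [|[/pn0//|]] := pos_total p; first by exists p.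
  by exists (- (p : G)).
have dense (a b : G) : pos (b - a) -> exists c : G, pos (c - a) /\ pos (b - c).
  move=> /(pos_scale (q := 2%:R^-1))-/(_ isT) half.
  have two (x : G) : x = 2%:R^-1 *: (x + x).
    by rewrite -mulr2n -scaler_nat scalerA mulVf // scale1r.
  exists (2%:R^-1 *: (a + b)); split.
    by rewrite [X in _ - X]two -scalerBr opprD addrACA subrr add0r.
  by rewrite [X in X - _]two -scalerBr opprD addrACA subrr addr0.
split=> //; first by move=> b a c; apply: tr.
- by move=> a b /slt_pos/dense[c [ac cb]]; exists c; split; apply/slt_pos.
- by move=> a; exists ((a : G) - e : G); apply/slt_pos; rewrite opprB addrC subrK.
- by move=> a; exists ((a : G) + e : G); apply/slt_pos; rewrite addrAC subrr add0r.
Qed.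

End GroupStructure.
End OrderedGroups.

(** * Generic rational directions *)

Section LinearAlgebra.
Import Order.TTheory GRing.Theory Num.Theory.
Local Open Scope ring_scope.

Lemma rat_avoid (s : seq rat) : exists t, t \notin s.
Proof.
have bound x : x \in s -> x <= \sum_(y <- s) `|y|.
  by move=> xs; rewrite (big_rem x) //= (le_trans (ler_norm x)) // lerDl sumr_ge0.
exists (1 + \sum_(y <- s) `|y|); apply/negP => /bound.
by rewrite gerDr ler10.
Qed.

(** A vector space over an infinite field is not a finite union of proper subspaces. Here the space
    is the kernel of [A], and a row outside the row space of [A] does not vanish identically on
    it. *)
Lemma generic_direction L n (A : 'M[rat]_(L, n)) (s : seq 'rV[rat]_n) :
  (forall r, r \in s -> ~~ (r <= A)%MS) ->
  exists d : 'cV[rat]_n, A *m d = 0 /\ forall r, r \in s -> (r *m d) 0 0 != 0.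
Proof.
elim: s => [|r s IH] hs; first by exists 0; rewrite mulmx0.
have [|d [Ad ds]] := IH; first by move=> r' r's; apply: hs; rewrite inE r's orbT.
have [d' [Ad' rd']] : exists d' : 'cV[rat]_n, A *m d' = 0 /\ (r *m d') 0 0 != 0.
  have := hs r (mem_head _ _); rewrite submxE => /eqP ne.
  have [j rj] : exists j, (r *m cokermx A) 0 j != 0.
    apply: contrapT => /forallNP all0; apply: ne; apply/matrixP => i j; rewrite ord1 [RHS]mxE.
    by apply/eqP/negPn/negP/all0.
  exists (col j (cokermx A)); split; first by rewrite colE mulmxA mulmx_coker mul0mx.
  by rewrite colE mulmxA -colE [_ 0 0]mxE.
(* If [r'] is nonzero on [d'], this is the only [t] for which it vanishes on [d + t *: d']. *)
pose bad (r' : 'rV[rat]_n) := - (r' *m d) 0 0 / (r' *m d') 0 0.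
have [t tP] := rat_avoid [seq bad r' | r' <- r :: s].
exists (d + t *: d'); split; first by rewrite mulmxDr -scalemxAr Ad Ad' scaler0 addr0.
move=> r' r's; rewrite mulmxDr -scalemxAr !mxE.
have [z|nz] := eqVneq ((r' *m d') 0 0) 0.
  move: r's; rewrite inE => /orP[/eqP E|/ds]; first by rewrite -E z eqxx in rd'.
  by move: z; rewrite !mxE => ->; rewrite mulr0 addr0.
apply/negP => /eqP e; move/negP: tP; apply; apply/mapP; exists r' => //.
rewrite /bad; apply: (mulIf nz); rewrite divfK // !mxE; apply/eqP.
by rewrite -addr_eq0 addrC e.
Qed.

End LinearAlgebra.

(** * Signs and small perturbations *)

Section OrderedGroupGeometry.
Import Order.TTheory GRing.Theory Num.Theory.
Local Open Scope ring_scope.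
Variables (M : lstruct) (modM : models DOAG M).
Notation G := (doag_group modM).
Notation env := (nat -> G).

Definition same_sign (x y : G) := (pos x <-> pos y) /\ (pos (- x) <-> pos (- y)).

Lemma same_sign_refl x : same_sign x x. Proof. by split. Qed.
Lemma same_sign_sym x y : same_sign x y -> same_sign y x.
Proof. by case=> h1 h2; split; rewrite ?h1 ?h2. Qed.
Lemma same_sign_trans y x z : same_sign x y -> same_sign y z -> same_sign x z.
Proof. by case=> h1 h2 [h3 h4]; split; rewrite ?h1 ?h2. Qed.

Lemma same_sign_pos x y : pos x -> pos y -> same_sign x y.
Proof. by move=> px py; split; split=> // /pos_asym; rewrite ?opprK; case. Qed.

Lemma same_sign_neg x y : pos (- x) -> pos (- y) -> same_sign x y.
Proof. by move=> px py; split; split=> // /pos_asym; case. Qed.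

Lemma same_sign0 x y : same_sign x y -> x = 0 <-> y = 0.
Proof.
have aux u v : same_sign u v -> u = 0 -> v = 0.
  move=> [h1 h2] u0; have [/h1|[//|/h2]] := pos_total v; rewrite u0 ?oppr0; by move/pos0.
by move=> s; split; apply: aux => //; apply: same_sign_sym.
Qed.

Lemma not_same_sign x y : ~ same_sign x y -> x <> 0 -> y <> 0 ->
  (pos x /\ pos (- y)) \/ (pos (- x) /\ pos y).
Proof.
move=> ns x0 y0; have [px|[//|nx]] := pos_total x; have [py|[//|ny]] := pos_total y.
- by case: ns; apply: same_sign_pos.
- by left.
- by right.
- by case: ns; apply: same_sign_neg.
Qed.

Lemma pos_scale_neg (q : rat) (x : G) : q < 0 -> pos (- x) -> pos (q *: x).
Proof.
by move=> q0 px; rewrite -[q]opprK scaleNr -scalerN; apply: pos_scale; rewrite // oppr_gt0.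
Qed.

Lemma scale_neq0 (q : rat) (x : G) : q != 0 -> pos x -> q *: x <> 0.
Proof.
move=> q0 px; have [qn|qp|] := ltgtP q 0; last by move/eqP: q0.
  by move=> E; have := pos_scale_neg (x := - x) qn; rewrite opprK scalerN E oppr0 => /(_ px)/pos0.
by move=> E; have := pos_scale qp px; rewrite E => /pos0.
Qed.

Lemma small_below (I : finType) (c : I -> G) : exists tau, pos tau /\
  forall i, c i <> 0 -> pos (c i - tau) \/ pos (- c i - tau).
Proof.
have [p pp] : exists p : G, pos p.
  have [z0] := slt_inhabited (doag_dense_unbounded modM).
  have [y] := slt_above (doag_dense_unbounded modM) z0.
  by move=> /(slt_pos (modM := modM)) py; exists ((y : G) - (z0 : G)).
have : forall i, c i <> 0 -> i \notin enum I -> pos (c i - p) \/ pos (- c i - p).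
  by move=> i _; rewrite mem_enum.
suff [tau [pt h]] : exists tau, pos tau /\ forall i, i \in enum I -> c i <> 0 ->
    pos (c i - tau) \/ pos (- c i - tau).
  by move=> _; exists tau; split=> // i; apply: h; rewrite mem_enum.
elim: (enum I) => [|i s [tau [pt h]]]; first by exists p.
have shrink (x tau' : G) : pos (tau - tau') -> pos (x - tau) -> pos (x - tau').
  by move=> h1 h2; have := pos_add h1 h2; rewrite addrC addrA subrK.
have below (x : G) : pos x -> exists tau', [/\ pos tau', pos (tau - tau') & pos (x - tau')].
  move=> px; have half (y : G) : pos y -> pos (2%:R^-1 *: y) /\ pos (y - 2%:R^-1 *: y).
    move=> py; have h1 : pos (2%:R^-1 *: y) by apply: pos_scale.
    split=> //; suff -> : y - 2%:R^-1 *: y = 2%:R^-1 *: y by [].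
    by rewrite -{1}[y]scale1r -scalerBl; congr (_ *: _); field.
  have [xt|[/subr0_eq xt|tx]] := pos_total (tau - x).
  - have [h1 h2] := half x px; exists (2%:R^-1 *: x); split=> //.
    by have := pos_add xt h2; rewrite addrA subrK.
  - by have [h1 h2] := half tau pt; exists (2%:R^-1 *: tau); rewrite -xt.
  - have [h1 h2] := half tau pt; exists (2%:R^-1 *: tau); split=> //.
    by move: tx; rewrite opprB => tx; have := pos_add tx h2; rewrite addrA subrK.
have [p1|[z|p1]] := pos_total (c i).
- have [tau' [pt' tt' xt']] := below _ p1; exists tau'; split=> // j.
  rewrite inE => /orP[/eqP->|js /(h j js)[?|?]]; first by left.
    by left; apply: shrink tt' _.
  by right; apply: shrink tt' _.
- by exists tau; split=> // j; rewrite inE => /orP[/eqP->|/h//].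
- have [tau' [pt' tt' xt']] := below _ p1; exists tau'; split=> // j.
  rewrite inE => /orP[/eqP->|js /(h j js)[?|?]]; first by right.
    by left; apply: shrink tt' _.
  by right; apply: shrink tt' _.
Qed.

Lemma small_perturbation (I : finType) (c : I -> G) (B : rat) : exists tau, pos tau /\
  forall i rho, c i <> 0 -> `|rho| <= B -> same_sign (c i + rho *: tau) (c i).
Proof.
have [tau0 [pt0 h]] := small_below c.
(* The added 1 makes [C] positive and larger than [B]: a coefficient bounded by [B] falls below 1
   after division, and the perturbation stays smaller than [tau0], which bounds every nonzero [c i]
   from below in absolute value. *)
pose C := `|B| + 1; have C0 : 0 < C by rewrite ltr_wpDl.
have pt : pos (C^-1 *: tau0) by apply: pos_scale; rewrite // invr_gt0.
exists (C^-1 *: tau0); split=> // i rho ci rB.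
have lt1 : `|rho / C| < 1.
  rewrite normrM normfV [`|C|]gtr0_norm // ltr_pdivrMr // mul1r.
  by rewrite (le_lt_trans rB) // (le_lt_trans (ler_norm B)) // ltrDl.
have [lo hi] : -1 < rho / C /\ rho / C < 1 by move: lt1; rewrite ltr_norml => /andP[].
rewrite scalerA; set q := rho / C in lo hi *.
have [ci'|ci'] := h i ci.
  have pc : pos (c i) by have := pos_add ci' pt0; rewrite subrK.
  apply: same_sign_pos => //; have -> : c i + q *: tau0 = (c i - tau0) + (1 + q) *: tau0.
    by rewrite scalerDl scale1r addrA subrK.
  by apply: pos_add => //; apply: pos_scale; rewrite // -ltrBlDl sub0r.
have pc : pos (- c i) by have := pos_add ci' pt0; rewrite subrK.
apply: same_sign_neg => //; have -> : - (c i + q *: tau0) = (- c i - tau0) + (1 - q) *: tau0.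
  by rewrite scalerBl scale1r addrA subrK opprD.
by apply: pos_add => //; apply: pos_scale; rewrite // subr_gt0.
Qed.

End OrderedGroupGeometry.

(** * Rational affine functionals and the crossing of their zero sets *)

Section AffineFunctionals.
Import Order.TTheory GRing.Theory Num.Theory.
Local Open Scope ring_scope.
Variables (M : lstruct) (modM : models DOAG M).
Notation G := (doag_group modM).
Let ordM := doag_dense_unbounded modM.

Inductive affine : ((nat -> G) -> G) -> Prop :=
| affine_var i : affine (fun v => v i)
| affine_const a : affine (fun=> a)
| affine_add t s of affine t & affine s : affine (fun v => t v + s v)
| affine_scale (q : rat) t of affine t : affine (fun v => q *: t v).

Lemma affine_sub t s : affine t -> affine s -> affine (fun v => t v - s v).
Proof.
move=> at_ as_; have := affine_add at_ (affine_scale (-1) as_).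
by congr affine; apply: funext => v; rewrite scaleN1r.
Qed.

Lemma affine_split i t : affine t -> exists (k : rat) r,
  [/\ affine r, @indep M i r & forall v, t v = k *: v i + r v].
Proof.
elim=> [j|a|{}t s _ [k [r [ar ir tE]]] _ [k' [r' [ar' ir' sE]]]|q {}t _ [k [r [ar ir tE]]]].
- have [->|ji] := eqVneq j i.
    exists 1, (fun=> 0); split=> //; first exact: affine_const.
    by move=> v; rewrite scale1r addr0.
  exists 0, (fun v => v j); split; first exact: affine_var.
    by move=> v z; rewrite /upd (negPf ji).
  by move=> v; rewrite scale0r add0r.
- exists 0, (fun=> a); split=> //; first exact: affine_const.
  by move=> v; rewrite scale0r add0r.
- exists (k + k'), (fun v => r v + r' v); split; first exact: affine_add.
    by move=> v z; rewrite (ir v z) (ir' v z).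
  by move=> v; rewrite tE sE scalerDl addrACA.
exists (q * k), (fun v => q *: r v); split; first exact: affine_scale.
  by move=> v z; rewrite (ir v z).
by move=> v; rewrite tE scalerDr scalerA.
Qed.

Lemma equi_sign_scale (q : rat) (t s t' s' : (nat -> G) -> G) : 0 < q ->
  (forall v, s v - t v = q *: (s' v - t' v)) -> @equi_sign M t s t' s'.
Proof.
move=> q0 e v; rewrite !(slt_pos (modM := modM)) e pos_scaleE //; split=> //.
by rewrite -[t v - s v]opprB e -scalerN opprB pos_scaleE.
Qed.

Lemma affine_solve i t s : affine t -> affine s -> @solvable M affine i t s.
Proof.
move=> /(affine_split i)[k [r [ar ir tE]]] /(affine_split i)[k' [r' [ar' ir' sE]]].
have diff v : s v - t v = (k' - k) *: v i + (r' v - r v).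
  by rewrite tE sE opprD addrACA scalerBl.
have ad := affine_sub ar' ar.
have id : @indep M i (fun v => r' v - r v : G) by move=> v z; rewrite (ir v z) (ir' v z).
have [kk'|kk'|kk'] := ltgtP k k'.
- have k0 : 0 < k' - k by rewrite subr_gt0.
  constructor 3; exists (fun v => - (k' - k)^-1 *: (r' v - r v)); split.
  + exact: affine_scale.
  + by move=> v z; rewrite (ir v z) (ir' v z).
  + apply: (equi_sign_scale k0) => v; rewrite diff scaleNr opprK scalerDr scalerA.
    by rewrite mulfV ?gt_eqF // scale1r.
- have k0 : 0 < k - k' by rewrite subr_gt0.
  constructor 2; exists (fun v => (k - k')^-1 *: (r' v - r v)); split.
  + exact: affine_scale.
  + by move=> v z; rewrite (ir v z) (ir' v z).
  + apply: (equi_sign_scale k0) => v; rewrite diff scalerBr scalerA.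
    by rewrite mulfV ?gt_eqF // scale1r -[k' - k]opprB scaleNr addrC.
- constructor 1; exists (fun=> 0 : G), (fun v => r' v - r v); split=> //.
  + exact: affine_const.
  + apply: (@equi_sign_scale 1) => // v.
    by rewrite diff kk' subrr scale0r add0r scale1r subr0.
Qed.

Lemma affine_eval (t : term M) : term_ok DOAG t -> affine (fun v => eval v t).
Proof.
elim: t => [i|a||t IHt s IHs|t IH] /=.
- by move=> _; apply: affine_var.
- by move=> _; apply: (affine_const (a : G)).
- by move=> _; apply: (affine_const (0 : G)).
- by move=> /andP[/IHt ? /IHs ?]; apply: affine_add.
- move=> /IH at_; have := affine_scale (-1) at_; congr affine.
  by apply: funext => v; rewrite scaleN1r.
Qed.

Definition dot n (r : 'rV[rat]_n) (a : n.-tuple M) : G := \sum_i r 0 i *: (tnth a i : G).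

Lemma dotD n (r s : 'rV_n) a : dot (r + s) a = dot r a + dot s a.
Proof. by rewrite -big_split; apply: eq_bigr => i _; rewrite mxE scalerDl. Qed.

Lemma dotZ n q (r : 'rV_n) a : dot (q *: r) a = q *: dot r a.
Proof. by rewrite scaler_sumr; apply: eq_bigr => i _; rewrite mxE scalerA. Qed.

Lemma dot0 n (a : n.-tuple M) : dot 0 a = 0.
Proof. by apply: big1 => i _; rewrite mxE scale0r. Qed.

Lemma dot_delta n k (a : n.-tuple M) : dot (delta_mx 0 k) a = tnth a k.
Proof.
rewrite /dot (bigD1 k) //= big1 => [|i ik]; first by rewrite mxE !eqxx scale1r addr0.
by rewrite mxE (negPf ik) andbF scale0r.
Qed.

Definition shift n (a : n.-tuple M) (e : G) (d : 'cV[rat]_n) : n.-tuple M :=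
  [tuple (tnth a i : G) + d i 0 *: e | i < n].

Lemma dot_shift n r (a : n.-tuple M) e d : dot r (shift a e d) = dot r a + (r *m d) 0 0 *: e.
Proof.
rewrite mxE scaler_suml -big_split; apply: eq_bigr => i _ /=.
by rewrite tnth_mktuple scalerDr scalerA.
Qed.

Variables n m : nat.

Lemma affine_dot t : affine t -> exists (u : 'rV[rat]_n) (w : 'rV[rat]_m) (c : G),
  forall a b, t (env2 a b (fun=> 0 : G)) = dot u a + dot w b + c.
Proof.
elim=> [j|c|{}t s _ [u [w [c tE]]] _ [u' [w' [c' sE]]]|q {}t _ [u [w [c tE]]]].
- have [[k kP]|[k kP]|kP] := env2_cases n m (fun=> 0 : G) j.
  + exists (delta_mx 0 k), 0, 0 => a b.
    by rewrite kP dot_delta dot0 !addr0.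
  + exists 0, (delta_mx 0 k), 0 => a b.
    by rewrite kP dot_delta dot0 add0r addr0.
  + by exists 0, 0, 0 => a b; rewrite kP !dot0 !addr0.
- by exists 0, 0, c => a b; rewrite !dot0 !add0r.
- exists (u + u'), (w + w'), (c + c') => a b.
  by rewrite tE sE !dotD addrACA; congr (_ + _); rewrite addrACA.
by exists (q *: u), (q *: w), (q *: c) => a b; rewrite tE !dotZ !scalerDr.
Qed.

Section Family.
Variables (L : nat) (u : 'M[rat]_(L, n)) (w : 'M[rat]_(L, m)) (c : 'I_L -> G).
Notation point := (n.-tuple M * m.-tuple M)%type.

Definition fval (z : point) (l : 'I_L) : G := dot (row l u) z.1 + dot (row l w) z.2 + c l.

Definition val_env (l : 'I_L) (v : nat -> G) : G :=
  \sum_(i < n) u l i *: v i + \sum_(j < m) w l j *: v (n + j)%N + c l.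

Lemma affine_sum k (q : 'I_k -> rat) (t : 'I_k -> (nat -> G) -> G) :
  (forall i, affine (t i)) -> affine (fun v => \sum_i q i *: t i v).
Proof.
move=> at_; elim: (index_enum _) => [|i s IH].
  by have := affine_const 0; congr affine; apply: funext => v; rewrite big_nil.
have := affine_add (affine_scale (q i) (at_ i)) IH; congr affine.
by apply: funext => v; rewrite big_cons.
Qed.

Lemma affine_val_env l : affine (val_env l).
Proof.
apply: affine_add (affine_const _); apply: affine_add; apply: affine_sum => i; exact: affine_var.
Qed.

Lemma val_env_env2 l z r : val_env l (env2 z.1 z.2 r) = fval z l.
Proof.
congr (_ + _ + _); apply: eq_bigr => i _; rewrite mxE.
  by rewrite env2_left.
by rewrite env2_right.
Qed.

Lemma val_env_point l (v : nat -> G) :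
  val_env l v = fval ([tuple v i | i < n], [tuple v (n + j)%N | j < m]) l.
Proof.
by congr (_ + _ + _); apply: eq_bigr => i _; rewrite mxE tnth_mktuple.
Qed.

(* The image of a polyhedron under [fval l] is, by Fourier-Motzkin elimination,
   the solution set of one-variable literals; it is order-convex, so it contains
   0 whenever it has elements of both signs. *)
Lemma wall_point z z' l : pos (- fval z l) -> pos (fval z' l) ->
  exists z0, fval z0 l = 0 /\
    forall i, same_sign (fval z i) (fval z' i) -> same_sign (fval z0 i) (fval z i).
Proof.
move=> neg_z pos_z'; pose p := (n + m)%N.
pose zero : (nat -> M) -> M := fun=> (0 : G).
(* The polyhedron: every functional with a common sign at [z] and [z'] must keep it. Vanishing is
   expressed by two non-strict literals. *)
pose lits (i : 'I_L) : seq (literal M) :=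
  if `[< same_sign (fval z i) (fval z' i) >] then
    if `[< pos (fval z i) >] then [:: (true, (zero, val_env i))]
    else if `[< pos (- fval z i) >] then [:: (true, (val_env i : (nat -> M) -> M, zero))]
    else [:: (false, (zero, val_env i)); (false, (val_env i : (nat -> M) -> M, zero))]
  else [::].
(* Variable [p], the first one after those of [x] and [y], carries the value of functional [l].
   Eliminating all variables below [p] describes the image of the polyhedron. *)
pose graph : seq (literal M) := [:: (false, (val_env l : (nat -> M) -> M, fun v => v p));
  (false, (fun v => v p, val_env l : (nat -> M) -> M))].
pose all_lits := graph ++ List.flat_map lits (enum 'I_L).
have a0 : affine zero by apply: affine_const.
have av i := affine_val_env i; have al := av l.
have ap : affine (fun v => v p) by apply: affine_var.
have ok : @literals M affine all_lits.
  apply/In_cat_all; split; first by move=> x [<-|[<-|[]]].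
  move=> x /List.in_flat_map[i [_]]; have ai := av i; rewrite /lits.
  case: ifP => // _; case: ifP => _; first by case=> [<-|[]].
  by case: ifP => _; [case=> [<-|[]]|case=> [<-|[<-|[]]]].
have pos_zero (v : nat -> M) (x : G) : @slt M (zero v) x <-> pos x.
  by rewrite (slt_pos (modM := modM)) subr0.
have neg_zero (v : nat -> M) (x : G) : @slt M x (zero v) <-> pos (- x).
  by rewrite (slt_pos (modM := modM)) sub0r.
have litsP i v : @holds_all M (lits i) v <->
    (same_sign (fval z i) (fval z' i) -> same_sign (val_env i v) (fval z i)).
  rewrite /lits; case: asboolP => [ss|nss]; last by split=> // _ x [].
  case: asboolP => [pz|npz].
    split=> [h _|/(_ ss)[h _] x [<-|[]]].
      by apply: same_sign_pos => //; apply/(pos_zero v); apply: (h _ (or_introl erefl)).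
    by apply/(pos_zero v); tauto.
  case: asboolP => [nz|nnz].
    split=> [h _|/(_ ss)[_ h] x [<-|[]]].
      by apply: same_sign_neg => //; apply/(neg_zero v); apply: (h _ (or_introl erefl)).
    by apply/(neg_zero v); tauto.
  split=> [h _|/(_ ss)[h1 h2] x [<-|[<-|[]]]].
  - have := h _ (or_introl erefl); have := h _ (or_intror (or_introl erefl)).
    rewrite /holds /= (pos_zero v) (neg_zero v); rewrite /same_sign; tauto.
  - by rewrite /holds /= (neg_zero v); tauto.
  - by rewrite /holds /= (pos_zero v); tauto.
have graphP v : @holds_all M graph v <-> val_env l v = v p.
  split=> [h|E x].
    have := h _ (or_introl erefl); have := h _ (or_intror (or_introl erefl)).
    by have [?|[->|?]] := slt_total ordM (val_env l v) (v p).
  by case=> [<-|[<-|[]]]; rewrite /holds /= E; apply: (slt_irr ordM).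
have allP v : @holds_all M all_lits v <-> val_env l v = v p /\
    forall i, same_sign (fval z i) (fval z' i) -> same_sign (val_env i v) (fval z i).
  rewrite /holds_all In_cat_all -graphP; split=> -[h1 h2]; split=> //.
    move=> i; apply/litsP => x xi; apply: h2; apply/List.in_flat_map; exists i; split=> //.
    elim: (enum 'I_L) (mem_enum 'I_L i) => // j s IH.
    by rewrite inE => /orP[/eqP->|/IH]; [left|right].
  by move=> x /List.in_flat_map[i [_ xi]]; apply: (proj2 (litsP i v) (h2 i)) xi.
have [l' okl' l'P] := eliminate_all ordM affine_solve p ok.
pose v0 : nat -> M := fun=> (0 : G).
have fiber y : (forall i, same_sign (fval z i) (fval z' i) -> same_sign (fval y i) (fval z i)) ->
    @holds_all M l' (@upd M v0 p (fval y l)).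
  move=> hy; apply/l'P; exists (env2 y.1 y.2 (@upd M v0 p (fval y l))); split.
    by move=> j pj; rewrite /env2 !ltnNge pj (leq_trans _ pj) ?leq_addr.
  apply/allP; rewrite !val_env_env2; split; last by move=> i; rewrite val_env_env2; apply: hy.
  by rewrite /env2 !ltnNge leqnn leq_addr /upd eqxx.
have hz := fiber z (fun i _ => same_sign_refl _).
have hz' := fiber z' (fun i h => same_sign_sym h).
have z_neg : @slt M (fval z l) (0 : G) by apply/(slt_pos (modM := modM)); rewrite sub0r.
have z'_pos : @slt M (0 : G) (fval z' l) by [].
have /l'P[v [vE /allP[v1 v2]]] := literals_convex ordM affine_solve okl' hz hz' z_neg z'_pos.
exists ([tuple v i | i < n], [tuple v (n + j)%N | j < m]); split.
  by rewrite -val_env_point v1 (vE p (leqnn p)) /upd eqxx.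
by move=> i /v2; rewrite val_env_point.
Qed.

(** Its row space is the span of the rows indexed by [K]; zeroing the other rows keeps the index
    type fixed while [K] varies. *)
Definition mask k (K : {set 'I_L}) (A : 'M[rat]_(L, k)) : 'M[rat]_(L, k) :=
  \matrix_(i, j) if i \in K then A i j else 0.

Lemma mask_row k K (A : 'M[rat]_(L, k)) (d : 'cV_k) i :
  mask K A *m d = 0 -> i \in K -> (row i A *m d) 0 0 = 0.
Proof.
move=> Kd iK; have -> : row i A = row i (mask K A).
  by apply/rowP => j; rewrite !mxE iK.
by rewrite -row_mul Kd !mxE.
Qed.

(** By duality, this says that [x] alone, and likewise [y] alone, has a rational direction that
    changes functional [l] while preserving all those in [K]. *)
Definition mixed (K : {set 'I_L}) (l : 'I_L) :=
  ~~ (row l u <= mask K u)%MS && ~~ (row l w <= mask K w)%MS.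

Lemma val_shift z e e' d d' l :
  fval (shift z.1 e d, shift z.2 e' d') l =
  fval z l + (row l u *m d) 0 0 *: e + (row l w *m d') 0 0 *: e'.
Proof.
rewrite /fval /= !dot_shift addrACA -!addrA; congr (_ + (_ + _)).
by rewrite addrA addrC.
Qed.

(** A direction for [x] and one for [y] preserve [K] and affect all of [Delta]. They are scaled to
    have opposite effects [1/o] and [-1/o] on functional [l], so steps [q s] and [r t] make [o]
    times its value equal to [(q s - r t) *: tau2]. *)
Lemma half_graph z0 l (K Delta : {set 'I_L}) (o : rat) :
    o != 0 -> fval z0 l = 0 -> l \in Delta ->
    (forall i, i \in K -> fval z0 i = 0) ->
    (forall i, i \in Delta -> mixed K i) ->
    (forall i, i \notin Delta -> fval z0 i = 0 -> i \in K) ->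
  exists (a : nat -> n.-tuple M) (b : nat -> m.-tuple M), forall s t,
    [/\ forall i, i \notin Delta -> same_sign (fval (a s, b t) i) (fval z0 i),
        forall i, i \in Delta -> fval (a s, b t) i <> 0 &
        if (s <= t)%N then pos (o *: fval (a s, b t) l) else pos (- (o *: fval (a s, b t) l))].
Proof.
move=> o0 z0l lD z0K mixD zeroK.
have [d [Kd dD]] : exists d : 'cV[rat]_n, mask K u *m d = 0 /\
    forall r, r \in [seq row i u | i <- enum Delta] -> (r *m d) 0 0 != 0.
  apply: generic_direction => r /mapP[i]; rewrite mem_enum => /mixD/andP[h _] -> //.
have [d' [Kd' dD']] : exists d : 'cV[rat]_m, mask K w *m d = 0 /\
    forall r, r \in [seq row i w | i <- enum Delta] -> (r *m d) 0 0 != 0.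
  apply: generic_direction => r /mapP[i]; rewrite mem_enum => /mixD/andP[_ h] -> //.
have {}dD i : i \in Delta -> (row i u *m d) 0 0 != 0.
  by move=> iD; apply: dD; apply: map_f; rewrite mem_enum.
have {}dD' i : i \in Delta -> (row i w *m d') 0 0 != 0.
  by move=> iD; apply: dD'; apply: map_f; rewrite mem_enum.
have aux k (B : 'M[rat]_(L, k)) (x : 'cV_k) (e : rat) : mask K B *m x = 0 ->
    (forall i, i \in Delta -> (row i B *m x) 0 0 != 0) -> e != 0 ->
    exists y : 'cV_k, [/\ (row l B *m y) 0 0 = e,
      forall i, i \in K -> (row i B *m y) 0 0 = 0 &
      forall i, i \in Delta -> (row i B *m y) 0 0 != 0].
  move=> Kx xD e0; have xl := xD l lD; pose f := (row l B *m x) 0 0.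
  have scale i : (row i B *m ((e / f) *: x)) 0 0 = e / f * (row i B *m x) 0 0.
    by rewrite -scalemxAr mxE.
  exists ((e / f) *: x); split=> [|i iK|i iD]; rewrite scale.
  - by rewrite divfK.
  - by rewrite (mask_row Kx iK) mulr0.
  - by rewrite !mulf_neq0 ?invr_eq0 // xD.
have [d1 [d1l d1K d1D]] := aux _ _ _ (o^-1) Kd dD ltac:(by rewrite invr_eq0).
have [d2 [d2l d2K d2D]] := aux _ _ _ (- o^-1) Kd' dD' ltac:(by rewrite oppr_eq0 invr_eq0).
pose al i := (row i u *m d1) 0 0; pose be i := (row i w *m d2) 0 0.
(* One bound serves both moves, as their rational step lengths are at most 1 in absolute value. *)
pose B := \sum_i (`|al i| + `|be i|).
have small i q r : `|q| <= 1 -> `|r| <= 1 -> `|al i * q + be i * r| <= B.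
  move=> q1 r1; have ab : `|al i| + `|be i| <= B.
    by rewrite /B (bigD1 i) //= lerDl sumr_ge0 // => j _; rewrite addr_ge0.
  apply: le_trans ab; apply: (le_trans (ler_normD _ _)); rewrite !normrM.
  by apply: lerD; rewrite ler_piMr.
(* The first move, along both [d1] and [d2], forces [be i = - al i] for every [i] in
   [Delta] with [fval z1 i = 0]; the second move then gives such an [i] a nonzero
   multiple of [q s - r t]. *)
have [tau1 [pt1 h1]] := small_perturbation (fval z0) B.
pose z1 := (shift z0.1 tau1 d1, shift z0.2 tau1 d2).
have z1E i : fval z1 i = fval z0 i + (al i + be i) *: tau1.
  by rewrite /z1 val_shift -/(al i) -/(be i) scalerDl addrA.
have sum_le i : `|al i + be i| <= B by have := @small i 1 1; rewrite !mulr1 normr1; apply.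
have [tau2 [pt2 h2]] := small_perturbation (fval z1) B.
(* The numbers [1/(2s+1)] and [1/(2t+2)] interleave: [r t < q s] exactly when [s <= t]. *)
pose q s : rat := (s.*2.+1)%:R^-1; pose r t : rat := (t.*2.+2)%:R^-1.
have q1 s : `|q s| <= 1 by rewrite ger0_norm ?invr_ge0 // invf_le1 ?ltr0n // ler1n.
have r1 t : `|r t| <= 1 by rewrite ger0_norm ?invr_ge0 // invf_le1 ?ltr0n // ler1n.
have qr s t : if (s <= t)%N then r t < q s else q s < r t.
  case: leqP => st; rewrite /q /r ltf_pV2 ?posrE ?ltr0n // ltr_nat.
    by rewrite !ltnS leq_double.
  by rewrite ltnS -doubleS leq_double.
exists (fun s => shift z1.1 (q s *: tau2) d1), (fun t => shift z1.2 (r t *: tau2) d2) => s t.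
have zE i : fval (shift z1.1 (q s *: tau2) d1, shift z1.2 (r t *: tau2) d2) i =
    fval z1 i + (al i * q s + be i * r t) *: tau2.
  by rewrite val_shift -/(al i) -/(be i) !scalerA scalerDl addrA.
have stay i : fval z1 i <> 0 ->
    same_sign (fval (shift z1.1 (q s *: tau2) d1, shift z1.2 (r t *: tau2) d2) i) (fval z1 i).
  by move=> nz; rewrite zE; apply: h2 => //; apply: small.
have nqr : q s - r t != 0.
  by rewrite subr_eq0; have := qr s t; case: leqP => _ lt; rewrite ?(lt_eqF lt) ?(gt_eqF lt).
have z1l : fval z1 l = 0 by rewrite z1E z0l /al /be d1l d2l subrr scale0r addr0.
split=> [i iD|i iD|].
(* A functional outside [Delta] that vanishes at [z0] is in [K], hence untouched by both moves; a
   nonzero one survives two small perturbations. *)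
- have [z0i|/eqP z0i] := eqVneq (fval z0 i) 0.
    have iK := zeroK i iD z0i; rewrite zE z1E z0i /al /be d1K // d2K //.
    by rewrite !mul0r !addr0 !scale0r !addr0.
  have z1i : same_sign (fval z1 i) (fval z0 i) by rewrite z1E; apply: h1.
  apply: (same_sign_trans _ z1i); apply: stay => E; apply: z0i.
  exact/(same_sign0 z1i).
- have [z1i|/eqP z1i] := eqVneq (fval z1 i) 0; last first.
    by move/(same_sign0 (stay i z1i)).
  have ab : al i + be i = 0.
    apply: contrapT => /eqP nz; have [z0i|/eqP z0i] := eqVneq (fval z0 i) 0.
      by move: z1i; rewrite z1E z0i add0r; apply: scale_neq0.
    by case: (z0i); apply/(same_sign0 (h1 i _ z0i (sum_le i))); rewrite -z1E.
  rewrite zE z1i add0r; apply: scale_neq0 => //.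
  have -> : be i = - al i by apply/eqP; rewrite -addr_eq0 addrC ab.
  by rewrite mulNr -mulrBr mulf_neq0 // d1D.
- rewrite zE z1l add0r scalerA /al /be d1l d2l mulNr -mulrBr mulrA mulfV // mul1r.
  have := qr s t; case: leqP => _ lt; first by apply: pos_scale; rewrite // subr_gt0.
  by rewrite -scaleNr; apply: pos_scale; rewrite // opprB subr_gt0.
Qed.


Definition vanishing z : {set 'I_L} := [set i | fval z i == 0].
Definition sign_diff z z' : {set 'I_L} := [set i | `[< ~ same_sign (fval z i) (fval z' i) >]].

Lemma sign_diffPn z z' i : i \notin sign_diff z z' -> same_sign (fval z i) (fval z' i).
Proof. by rewrite inE => /asboolPn/contrapT. Qed.

(** Suppose [D] fails at [z]. A point [(a s, b t)] with [s <= t] has the sign of [z'] at [l], and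
    induction carries [D] from [z'] to it. With [t < s] it has the sign of [z] at [l], and induction
    would carry [D] from it to [z]. So [D] is a half graph on these points. *)
Lemma same_sign_off_mixed (D : n.-tuple M -> m.-tuple M -> Prop) (K : {set 'I_L}) :
    stable2 D ->
    (forall z z', (forall i, same_sign (fval z i) (fval z' i)) -> D z.1 z.2 -> D z'.1 z'.2) ->
  forall z z', vanishing z = K -> vanishing z' = K ->
    (forall i, i \in sign_diff z z' -> mixed K i) -> D z'.1 z'.2 -> D z.1 z.2.
Proof.
move=> stD resp z z'; have [N] := ubnP #|sign_diff z z'|.
elim: N z z' => // N IH z z' ltN zK z'K mixD Dz'.
have vanP x i : vanishing x = K -> fval x i = 0 <-> i \in K.
  by move=> <-; rewrite inE; split=> [->|/eqP].
have [d0|[l lD]] := set_0Vmem (sign_diff z z').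
  apply: resp Dz' => i; apply/same_sign_sym/sign_diffPn.
  by rewrite d0 inE.
have lK : l \notin K.
  apply/negP => lK; move: lD; rewrite inE => /asboolP; apply.
  by rewrite (proj2 (vanP z l zK) lK) (proj2 (vanP z' l z'K) lK).
have nz x : vanishing x = K -> fval x l <> 0 by move=> xK /(vanP x l xK); apply/negP.
(* The factor [o] is a sign that makes functional [l] pass from negative at [z] to positive at
   [z']. *)
have [o [o0 oz oz']] : exists o : rat, [/\ o != 0, pos (- (o *: fval z l)) & pos (o *: fval z' l)].
  move: (lD); rewrite inE => /asboolP/not_same_sign/(_ (nz z zK) (nz z' z'K))[[h h']|[h h']].
    by exists (- 1); rewrite !scaleN1r opprK.
  by exists 1; rewrite !scale1r.
have [z0 [z0l z0E]] : exists z0, fval z0 l = 0 /\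
    forall i, same_sign (fval z i) (fval z' i) -> same_sign (fval z0 i) (fval z i).
  move: (lD); rewrite inE => /asboolP/not_same_sign/(_ (nz z zK) (nz z' z'K))[[h h']|[h h']].
    have [z0 [z0l hz0]] := wall_point h' h; exists z0; split=> // i ss.
    by apply: same_sign_trans (hz0 i (same_sign_sym ss)) (same_sign_sym ss).
  exact: wall_point h h'.
have z0K i : i \in K -> fval z0 i = 0.
  move=> iK; apply/(same_sign0 (z0E i _)); last exact/(vanP z i zK).
  by rewrite (proj2 (vanP z i zK) iK) (proj2 (vanP z' i z'K) iK).
have zeroK i : i \notin sign_diff z z' -> fval z0 i = 0 -> i \in K.
  by move=> iD z0i; apply/(vanP z i zK)/(same_sign0 (z0E i (sign_diffPn iD))).
have [a [b ab]] := half_graph o0 z0l lD z0K mixD zeroK.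
apply: contrapT => nDz; apply: stD; exists a, b => s t.
have [off on side] := ab s t; set y := (a s, b t) in off on side.
have yz i : i \notin sign_diff z z' -> same_sign (fval y i) (fval z i).
  by move=> iD; apply: same_sign_trans (off i iD) (z0E i (sign_diffPn iD)).
have yK : vanishing y = K.
  apply/setP => i; rewrite inE; apply/eqP/idP => [yi|iK].
    have [iD|iD] := boolP (i \in sign_diff z z'); first by case: (on i iD).
    by apply/(vanP z i zK)/(same_sign0 (yz i iD)).
  have iD : i \notin sign_diff z z'.
    rewrite inE; apply/asboolPn; rewrite notK.
    by rewrite (proj2 (vanP z i zK) iK) (proj2 (vanP z' i z'K) iK).
  by apply/(same_sign0 (yz i iD))/(vanP z i zK).
have unscale (x x' : G) : same_sign (o *: x) (o *: x') -> same_sign x x'.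
  have [oneg|opos|E] := ltgtP o 0; last by rewrite E eqxx in o0.
    have no : 0 < - o by rewrite oppr_gt0.
    have flip y' : o *: y' = - o *: (- y') by rewrite scaleNr scalerN opprK.
    by rewrite /same_sign !flip -!scalerN !pos_scaleE // !opprK; tauto.
  by rewrite /same_sign -!scalerN !pos_scaleE.
have closer x : same_sign (fval y l) (fval x l) -> sign_diff y x \subset sign_diff z z' ->
    (#|sign_diff y x| < #|sign_diff z z'|)%N.
  move=> ss sub; apply: proper_card; apply/properP; split=> //; exists l => //.
  by rewrite inE; apply/asboolPn; rewrite notK.
have sub x : (forall i, i \notin sign_diff z z' -> same_sign (fval z i) (fval x i)) ->
    sign_diff y x \subset sign_diff z z'.
  move=> h; apply/subsetP => i; apply: contraLR => iD.
  by rewrite inE; apply/asboolPn; rewrite notK; apply: same_sign_trans (yz i iD) (h i iD).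
move: side; case: leqP => st side; split=> // Dy.
  have ss : same_sign (fval y l) (fval z' l) by apply: unscale; apply: same_sign_pos.
  have sb := sub z' (@sign_diffPn z z').
  apply: (IH y z') => //; first exact: leq_trans (closer z' ss sb) ltN.
  by move=> i /(subsetP sb)/mixD.
case: nDz; have ss : same_sign (fval y l) (fval z l) by apply: unscale; apply: same_sign_neg.
have sb := sub z (fun i _ => same_sign_refl _).
have sw i : (i \in sign_diff z y) = (i \in sign_diff y z).
  by rewrite !inE; apply/asboolP/asboolP => h /same_sign_sym.
apply: (IH z y) => //; last by move=> i; rewrite sw => /(subsetP sb)/mixD.
by rewrite (eq_card sw); apply: leq_trans (closer z ss sb) ltN.
Qed.

(** When row [l] lies in the span of the rows in [K], these are the coefficients of one such
    combination. *)
Definition coefs k (K : {set 'I_L}) (A : 'M[rat]_(L, k)) l (i : 'I_L) : rat :=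
  (row l A *m pinvmx (mask K A)) 0 i.

Definition residual k (K : {set 'I_L}) (A : 'M[rat]_(L, k)) l (lam : 'I_L -> rat) : 'rV_k :=
  row l A - \sum_(i in K) lam i *: row i A.

Lemma residual_coefs k K (A : 'M[rat]_(L, k)) l :
  (row l A <= mask K A)%MS -> residual K A l (coefs K A l) = 0.
Proof.
move=> /mulmxKpV E; apply/eqP; rewrite /residual subr_eq0 -{1}E mulmx_sum_row.
rewrite [X in _ == X]big_mkcond /=; apply/eqP; apply: eq_bigr => i _.
case: ifP => iK; first by congr (_ *: _); apply/rowP => j; rewrite !mxE iK.
by apply/rowP => j; rewrite !mxE iK mulr0.
Qed.

Lemma dot_residual k K (A : 'M[rat]_(L, k)) l lam a :
  dot (residual K A l lam) a = dot (row l A) a - \sum_(i in K) lam i *: dot (row i A) a.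
Proof.
rewrite /residual dotD -scaleN1r dotZ scaleN1r; congr (_ - _).
elim/big_rec2: _ => [|i x y _ <-]; first exact: dot0.
by rewrite dotD dotZ.
Qed.

(** Subtracting multiples of functionals that vanish at [z] changes nothing. As [lam] is free, it
    can be chosen to cancel the part in [x] or the part in [y]. *)
Lemma val_residual (K : {set 'I_L}) z l (lam : 'I_L -> rat) : (forall i, i \in K -> fval z i = 0) ->
  fval z l = dot (residual K u l lam) z.1 + dot (residual K w l lam) z.2 +
            (c l - \sum_(i in K) lam i *: c i).
Proof.
move=> z0; rewrite !dot_residual [X in _ = X + _]addrACA -opprD [RHS]addrACA -opprD.
rewrite -!big_split /=.
rewrite big1 ?subr0 // => i iK.
by rewrite -!scalerDr -/(fval z i) z0 // scaler0.
Qed.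

(** To keep only [x], the coefficients are taken from the matrix [w] of the [y] part, which they
    cancel, and conversely. Off the flat of [K], or for a mixed functional, this need not equal
    [fval], but it still depends on one tuple only. *)
Definition pure_val (on_x : bool) K l (z : point) : G :=
  if on_x then dot (residual K u l (coefs K w l)) z.1 + (c l - \sum_(i in K) coefs K w l i *: c i)
  else dot (residual K w l (coefs K u l)) z.2 + (c l - \sum_(i in K) coefs K u l i *: c i).

Lemma not_mixed_val K l : ~~ mixed K l -> exists on_x, forall z,
  (forall i, i \in K -> fval z i = 0) -> fval z l = pure_val on_x K l z.
Proof.
rewrite negb_and !negbK => /orP[h|h]; [exists false|exists true] => z z0.
  by rewrite (val_residual l (coefs K u l) z0) (residual_coefs h) dot0 add0r.
by rewrite (val_residual l (coefs K w l) z0) (residual_coefs h) dot0 addr0.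
Qed.

End Family.
End AffineFunctionals.

(** * Definability by group terms and the equivalence for DOAG *)

Section OrderedGroupDefinability.
Import Order.TTheory GRing.Theory Num.Theory.
Local Open Scope ring_scope.
Variables (M : lstruct) (modM : models DOAG M).
Notation G := (doag_group modM).
Let ordM := doag_dense_unbounded modM.

Section Represented.
Variables (Z : Type) (E : Z -> (nat -> M) -> nat -> M).

(* The coefficients of [f] are rational, those of terms are integers: a
   positive multiple of [f] is represented by a term. *)
Definition represented (f : Z -> G) := exists (t : term M) (N : nat),
  [/\ term_ok DOAG t, (0 < N)%N & forall z r, (eval (E z r) t : G) = f z *+ N].

Lemma represented_const a : represented (fun=> a).
Proof. by exists (TPar (a : M)), 1%N. Qed.

Lemma represented_var (f : Z -> G) j : (forall z r, E z r j = f z) -> represented f.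
Proof. by move=> h; exists (TVar j), 1%N. Qed.

Lemma term_muln (t : term M) k : term_ok DOAG t -> exists t', term_ok DOAG t' /\
  forall v : nat -> M, (eval v t' : G) = (eval v t : G) *+ k.
Proof.
move=> okt; elim: k => [|k [t' [okt' tE]]]; first by exists TZero.
exists (TAdd t t'); rewrite /= okt okt'; split=> // v.
by rewrite mulrS -tE.
Qed.

Lemma represented_add f g : represented f -> represented g -> represented (fun z => f z + g z).
Proof.
move=> [t [N [okt N0 tE]]] [s [N' [oks N0' sE]]].
have [t' [okt' t'E]] := term_muln N' okt; have [s' [oks' s'E]] := term_muln N oks.
exists (TAdd t' s'), (N * N')%N; rewrite /= okt' oks' muln_gt0 N0; split=> // z r.
rewrite mulrnDl mulrnA -(tE z r) -t'E [(N * N')%N]mulnC mulrnA -(sE z r) -s'E //.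
Qed.

Lemma represented_scale (q : rat) f : represented f -> represented (fun z => q *: f z).
Proof.
move=> [t [N [okt N0 tE]]]; have [t' [okt' t'E]] := term_muln `|numq q| okt.
have d0 : (0 < `|denq q|)%N by rewrite absz_gt0 denq_neq0.
have scaleE z : (q *: f z) *+ (`|denq q| * N) = (f z *+ N) *~ numq q.
  by rewrite mulrnA (projT2 (scale_exists modM)) !pmulrn mulrzAC.
case: (numq q) t'E scaleE => k t'E scaleE.
  exists t', (`|denq q| * N)%N; rewrite muln_gt0 d0; split=> // z r.
  by rewrite scaleE t'E tE.
exists (TOpp t'), (`|denq q| * N)%N; rewrite muln_gt0 d0; split=> // z r.
by rewrite scaleE -(tE z r) NegzE mulrNz -pmulrn -t'E.
Qed.

Lemma represented_dot k (r : 'rV[rat]_k) (g : Z -> k.-tuple M) :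
  (forall i, represented (fun z => tnth (g z) i)) -> represented (fun z => dot modM r (g z)).
Proof.
move=> h; rewrite /dot; elim: (index_enum _) => [|i s IH].
  by have := represented_const 0; congr represented; apply: funext => z; rewrite big_nil.
have := represented_add (represented_scale (r 0 i) (h i)) IH; congr represented.
by apply: funext => z; rewrite big_cons.
Qed.

Lemma represented_zero f : represented f -> exists t : formula M,
  [/\ form_ok DOAG t, eq_qf t & forall z r, f z = 0 <-> sat (E z r) t].
Proof.
move=> [t [N [okt N0 tE]]]; exists (FEq t TZero); rewrite /= okt; split=> // z r.
rewrite tE; split=> [->|h]; first by rewrite mul0rn.
by apply: (mulrn_inj N0); rewrite mul0rn.
Qed.

Lemma represented_pos f : represented f -> exists t : formula M,
  form_ok DOAG t /\ forall z r, pos (f z) <-> sat (E z r) t.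
Proof.
move=> [t [N [okt N0 tE]]]; exists (FLt TZero t); rewrite /= okt; split=> // z r.
by rewrite tE -(pos_mulrnE _ N0).
Qed.
End Represented.

Variables n m : nat.
Implicit Types D Z : n.-tuple M -> m.-tuple M -> Prop.

Lemma definable1_pos k (r : 'rV[rat]_k) (e : G) (s : bool) :
  definable1 DOAG (fun a : k.-tuple M => pos ((-1) ^+ s *: (dot modM r a + e))).
Proof.
apply: represented_pos; apply/represented_scale/represented_add; last exact: represented_const.
by apply: represented_dot => i; apply: (represented_var (j := i)) => z v; rewrite env1_ord.
Qed.

(** Addition separates variables: both sides of an equation have the form [f(x) + g(y)], so it can
    be rewritten with [x] on one side and [y] on the other. *)
Lemma doag_tame Z : eq_definable2 DOAG Z -> tame Z.
Proof.
apply: tame_eq_definable; first exact: slt_inhabited ordM.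
move=> r t s okt oks; have split_term x : exists (f : n.-tuple M -> G) (g : m.-tuple M -> G),
    forall a b, eval (env2 a b r) x = f a + g b :> G.
  elim: x => [j|a||t1 [f1 [g1 h1]] t2 [f2 [g2 h2]]|t1 [f1 [g1 h1]]].
  - have [[k kP]|[k kP]|kP] := env2_cases n m r j.
    + by exists (fun a => tnth a k), (fun=> 0) => a b /=; rewrite kP addr0.
    + by exists (fun=> 0), (fun b => tnth b k) => a b /=; rewrite kP add0r.
    + by exists (fun=> 0), (fun=> r j) => a b /=; rewrite kP add0r.
  - by exists (fun=> 0), (fun=> a) => ? ?; rewrite add0r.
  - by exists (fun=> 0), (fun=> 0) => ? ?; rewrite add0r.
  - exists (fun a => f1 a + f2 a), (fun b => g1 b + g2 b) => a b.
    by rewrite addrACA -h1 -h2.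
  - by exists (fun a => - f1 a), (fun b => - g1 b) => a b; rewrite -opprD -h1.
have [f1 [g1 h1]] := split_term t; have [f2 [g2 h2]] := split_term s.
have := tame_eq (fun a => f1 a - f2 a) (fun b => g2 b - g1 b); congr tame.
apply: funext => a; apply: funext => b; apply/propext.
have -> : (eval (env2 a b r) t = eval (env2 a b r) s) = (f1 a + g1 b = f2 a + g2 b).
  by rewrite -h1 -h2.
split=> [h|h]; apply/eqP.
  by rewrite -[f1 a](subrK (f2 a)) h addrAC subrK addrC.
by rewrite subr_eq -addrA [- _ + _]addrC addrA eq_sym subr_eq addrC -h addrC.
Qed.

(** The functionals are the differences of the two sides of the literals that decide [D], with all
    variables beyond [x] and [y] set to 0. *)
Lemma doag_family D : definable2 DOAG D -> exists L (u : 'M[rat]_(L, n)) (w : 'M[rat]_(L, m)) c,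
  forall z z', (forall i, same_sign (@fval M modM n m L u w c z i) (fval u w c z' i)) ->
    D z.1 z.2 -> D z'.1 z'.2.
Proof.
case=> f [okf fP].
have [l okl lP] := determined_sat ordM (@affine_solve _ modM) (@affine_eval _ modM) okf.
pose r0 : nat -> M := fun=> (0 : G).
have [s sP] : exists s : seq ('rV[rat]_n * 'rV[rat]_m * G), forall c, List.In c l ->
    exists2 i, (i < size s)%N & forall a b,
      (c.2.2 (env2 a b r0) : G) - (c.2.1 (env2 a b r0) : G) =
      let x := nth (0, 0, 0) s i in dot modM x.1.1 a + dot modM x.1.2 b + x.2 :> G.
  elim: l okl {lP} => [|c l IH] okl; first by exists [::].
  have /IH[s sP] : @literals M (@affine _ modM) l by move=> x xl; apply: okl; right.
  have [a1 a2] := okl c (or_introl erefl).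
  have [u [w [e h]]] := affine_dot n m (affine_sub a2 a1).
  exists ((u, w, e) :: s) => x [<-|/sP[i si hi]]; first by exists 0%N.
  by exists i.+1.
exists (size s), (\matrix_(i, j) (nth (0, 0, 0) s i).1.1 0 j),
  (\matrix_(i, j) (nth (0, 0, 0) s i).1.2 0 j), (fun i => (nth (0, 0, 0) s i).2) => z z' ss.
move=> /(fP _ _ r0) Dz; apply/(fP _ _ r0); apply: lP Dz => -[b [t1 t2]] cl.
have [i si /= h] := sP _ cl; have := ss (Ordinal si); rewrite /fval /=.
have rowE k (F : 'I_(size s) -> 'rV[rat]_k) j : row j (\matrix_(i, j) F i 0 j) = F j.
  by apply/rowP => x; rewrite !mxE.
rewrite !(rowE _ (fun i => (nth (0, 0, 0) s i).1.1)).
rewrite !(rowE _ (fun i => (nth (0, 0, 0) s i).1.2)) /=.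
rewrite -!h /same_sign !opprB => -[h1 h2]; rewrite /holds /cmp /=.
by case: b {cl} => /=; rewrite !(slt_pos (modM := modM)) ?h1 ?h2.
Qed.

Lemma doag_special_union D : definable2 DOAG D -> stable2 D -> special_union DOAG D.
Proof.
move=> /doag_family[L [u [w [c resp]]]] stD.
(* [None] marks an equation; [Some (K, x, s)] marks the pure comparison on side [x] with sign [s]
   that is meant for points whose vanishing set is [K]. That set varies with the point, so all
   subsets are listed. *)
pose F : finType := (option ({set 'I_L} * bool * bool) * 'I_L)%type.
pose A (f : F) (a : n.-tuple M) (b : m.-tuple M) :=
  if f.1 is Some (K, x, s) then pos ((-1) ^+ (s : bool) *: pure_val u w c x K f.2 (a, b))
  else fval u w c (a, b) f.2 = 0.
apply: (special_union_determined (A := A)).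
  case=> [[[[K x] s]|] i].
    case: x; rewrite /A /pure_val /=; apply: su_special.
      exact: (special_stable_left _ (definable1_pos _ _ s)).
    exact: (special_stable_right _ (definable1_pos _ _ s)).
  apply/su_special/special_stable_eq.
  have rep : represented (fun (z : n.-tuple M * m.-tuple M) r => env2 z.1 z.2 r)
      (fun z => fval u w c z i).
    apply: represented_add (represented_const _ _); apply: represented_add;
    apply: represented_dot => j.
      by apply: (represented_var (j := j)) => z v; rewrite env2_left.
    by apply: (represented_var (j := (n + j)%N)) => z v; rewrite env2_right.
  have [f [okf ef fE]] := represented_zero rep.
  by exists f; split=> //; split=> // a b r; apply: (fE (a, b)).
move=> a b a' b' h; pose z := (a, b); pose z' := (a', b').
have vE : vanishing u w c z = vanishing u w c z'.
  apply/setP => i; have [h1 h2] := h (None, i); rewrite !inE.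
  by apply/eqP/eqP; [apply: h1|apply: h2].
apply: (same_sign_off_mixed stD resp (z := z') (z' := z) (esym vE) (erefl _)).
(* The two points lie on the same flat. There an unmixed functional equals a pure value, whose sign
   is among the listed comparisons, so it cannot differ in sign. *)
move=> i; apply: contraLR => /(not_mixed_val c)[x xP]; rewrite inE.
have zE : fval u w c z i = pure_val u w c x (vanishing u w c z) i z.
  by apply: xP => j; rewrite inE => /eqP.
have z'E : fval u w c z' i = pure_val u w c x (vanishing u w c z) i z'.
  by apply: xP => j; rewrite vE inE => /eqP.
apply/asboolPn; rewrite notK z'E zE.
have := h (Some (vanishing u w c z, x, false), i); have := h (Some (vanishing u w c z, x, true), i).
by rewrite /A /= expr0 expr1 !scale1r !scaleN1r /same_sign; tauto.
Qed.

Lemma doag_special_union_stable D : special_union DOAG D -> stable2 D.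
Proof. exact/special_union_stable/doag_tame. Qed.

End OrderedGroupDefinability.

Theorem theorem4p1 (T : theory) (M : lstruct) (HM : models T M) (n m : nat)
    (D : n.-tuple M -> m.-tuple M -> Prop) (HD : definable2 T D) :
  stable2 D <->
  exists (k : nat) (S : nat -> n.-tuple M -> m.-tuple M -> Prop),
    (forall i, i < k -> special_stable T (S i)) /\
    (forall a b, D a b <-> exists i, i < k /\ S i a b).
Proof.
rewrite -special_unionP; case: T HM HD => HM HD; split.
- exact: dlo_special_union.
- exact: dlo_special_union_stable.
- exact: (doag_special_union HM HD).
- exact: (doag_special_union_stable HM).
Qed.
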